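(* Let $n \ge 3$ be an integer, let $\varepsilon > 0$ and $\mu > 0$ be arbitrary, and let $\rho : (0,\infty) \to (0,\infty)$ be an arbitrary function. Then there exist a smooth function $K : \mathbb{R}^n \setminus \{0\} \to \mathbb{R}$ with $|K - 1| \le \varepsilon$ in $\mathbb{R}^n \setminus \{0\}$, a smooth positive function $u$ on $\mathbb{R}^n \setminus \{0\}$, an open set $U \subset \mathbb{R}^n \setminus \{0\}$ of Lebesgue measure at most $\mu$, and a sequence of points $x_i \in \mathbb{R}^n \setminus \{0\}$ with $|x_i| \to 0$ as $i \to \infty$, such that: (i) $$\Delta u + n(n-2)\, K\, u^{\frac{n+2}{n-2}} = 0 \quad \text{in } \mathbb{R}^n \setminus \{0\};$$ (ii) $u(x_i) \ge \rho(|x_i|)$ for all $i$, and $u(x_i)\,|x_i|^{\frac{n-2}{2}} \to \infty$ as $i \to \infty$; in particular $u$ is a blow-up solution; (iii) $K(x) = 1$ and $u(x) = u_s(x)$ for all $x \in (\mathbb{R}^n \setminus \{0\}) \setminus U$.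
   Context: $\Delta$ is the Euclidean Laplacian on $\mathbb{R}^n$. The canonical standard bubble is $u_s(x) = \left(\frac{1}{1+|x|^2}\right)^{\frac{n-2}{2}}$ for $x \in \mathbb{R}^n$. A positive smooth solution $u$ of the equation in (i) on $\mathbb{R}^n \setminus \{0\}$ is called a blow-up solution if it does not have slow decay near the origin, i.e. there does not exist a constant $C > 0$ such that $u(x) \le C |x|^{\frac{2-n}{2}}$ for all $x \in \mathbb{R}^n \setminus \{0\}$ with $|x|$ close to zero. *)

(* Defs.v *)
From HB Require Import structures.
From mathcomp Require Import all_boot all_order all_algebra.
From mathcomp Require Import all_classical all_reals all_analysis.

Set Implicit Arguments.
Unset Strict Implicit.
Unset Printing Implicit Defensive.

Import Order.TTheory GRing.Theory Num.Theory.
Import numFieldNormedType.Exports.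

Local Open Scope classical_set_scope.
Local Open Scope ring_scope.

Section Defs.
Context {R : realType} {n : nat}.
Implicit Types (x a b : 'rV[R]_n) (f u K : 'rV[R]_n -> R).

(* The library norm `|x| on row vectors is the sup norm; this is the Euclidean
   one. Both induce the canonical topology of 'rV[R]_n. *)
Definition enorm x : R := Num.sqrt (\sum_(i < n) x ord0 i ^+ 2).

(* Functions on R^n \ {0} are total functions whose value at 0 is never used:
   all the conditions below are local and restricted to this open set. *)
Definition punctured : set 'rV[R]_n := [set x | x != 0].

Definition partial (i : 'I_n) f : 'rV[R]_n -> R :=
  fun x => 'D_(delta_mx ord0 i : 'rV[R]_n) f x.

Definition partials (s : seq 'I_n) f : 'rV[R]_n -> R := foldr partial f s.

(* For D open: C^oo on D, i.e. the partial derivatives of all orders exist and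
   are continuous at every point of D. *)
Definition smooth_on (D : set 'rV[R]_n) f : Prop :=
  forall (s : seq 'I_n) x, D x ->
    {for x, continuous (partials s f)} /\
    forall i : 'I_n, derivable (partials s f) x (delta_mx ord0 i : 'rV[R]_n).

Definition laplacian f x : R := \sum_(i < n) partial i (partial i f) x.

Definition box a b : set 'rV[R]_n :=
  [set x | forall i : 'I_n, a ord0 i < x ord0 i <= b ord0 i].

Definition box_volume a b : R := \prod_(i < n) (b ord0 i - a ord0 i).

(* n-dimensional Lebesgue (outer) measure: infimum of the total volumes of the
   countable covers by half-open boxes. On Lebesgue measurable sets, hence on
   open sets, it is the Lebesgue measure. *)
Definition lebesgue_measure_rV (A : set 'rV[R]_n) : \bar R :=
  ereal_inf [set v : \bar R | exists a b : nat -> 'rV[R]_n,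
    [/\ forall k (i : 'I_n), a k ord0 i <= b k ord0 i,
        A `<=` \bigcup_k box (a k) (b k) &
        v = (\sum_(0 <= k <oo) (box_volume (a k) (b k))%:E)%E]].

Definition standard_bubble x : R :=
  (1 / (1 + enorm x ^+ 2)) `^ ((n%:R - 2) / 2).

Definition solves K u : Prop := forall x, punctured x ->
  laplacian u x
  + n%:R * (n%:R - 2) * K x * u x `^ ((n%:R + 2) / (n%:R - 2)) = 0.

Definition slow_decay u : Prop :=
  exists C : R, 0 < C /\ exists d : R, 0 < d /\
    forall x, punctured x -> enorm x < d ->
      u x <= C * enorm x `^ ((2 - n%:R) / 2).

Definition blow_up_solution K u : Prop :=
  [/\ smooth_on punctured u, forall x, punctured x -> 0 < u x,
      solves K u & ~ slow_decay u].

End Defs.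

(* Main.v *)
Require Import Defs.
From mathcomp Require Import all_boot all_order all_algebra.
From mathcomp Require Import all_classical all_reals all_analysis.
From mathcomp Require Import ring lra.

Import Order.TTheory GRing.Theory Num.Theory.
Import numFieldNormedType.Exports.

Local Open Scope classical_set_scope.
Local Open Scope ring_scope.

(** Write [N = - Laplacian / (n (n - 2))], [m = (n - 2) / 2] and
    [p = (n + 2) / (n - 2) = (m + 2) / m].  For any positive smooth [u] the
    equation holds with [K := N u / u ^ p], so the task is to find [u] with
    [|N u - u ^ p| <= eps * u ^ p]; no smallness of derivatives of [K] is asked,
    which leaves a lot of room.

    The function is [u = u_s + \sum_i phi_i], where [phi_i >= 0] is radial around
    [x_i = 2 ^ (- i) e_1], supported in a tiny ball, and huge at [x_i].  The balls
    are disjoint and accumulate only at 0, so near any [x != 0] the sum is finite,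
    and only one [phi_i] has to be considered at a time ([Superposition]).  On a
    small ball [u_s] is almost a constant [a], which reduces everything to one
    statement about radial functions ([local_bump]): there is [phi >= 0] of
    arbitrarily small support and arbitrarily large value at the centre with
    [|N phi - ((a + phi) ^ p - a ^ p)| <= e * (a + phi) ^ p].

    A concentrated bubble [w = (l / (l ^ 2 + |x| ^ 2)) ^ m] satisfies
    [N w = w ^ p] exactly, and [w ^ p] differs from [(a + w) ^ p - a ^ p] by the
    interaction term [G(w) = (a + w) ^ p - a ^ p - w ^ p].  Where [w] is much larger
    or much smaller than [a] this is within the tolerance, but in the intermediate
    zone [|x| ~ sqrt l] it is not.  There, however, [G(w)] is bounded and the zone is
    small, so [G(w)] can be produced as [N v] by a correction [v = O(l) w] that hardly
    changes [w] itself.  This is done with explicit functions.  In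
    the variable [z = l / (l + |x| ^ 2)], the operator [N] sends [l * z ^ (m + j)] to a
    combination of [z ^ (m + j + 2)] and [z ^ (m + j + 1)], the latter absent for
    [j = 0]; hence every [z ^ (m + 2) * Q(z)] with [Q] a polynomial is [N v] for
    some [v = l * z ^ m * P(z)] with [P] a polynomial ([triangular_system],
    [radialN_ansatz]), and the Weierstrass theorem provides [Q] with
    [z ^ (m + 2) * Q(z)] within the tolerance of [G(w)] ([interaction_approx]).  At a
    fixed distance from the centre, [w + v] and its derivatives are [O(l ^ m)], so
    that a fixed smooth cutoff costs nothing when [l] is small. *)

(** * Smooth functions *)
Section DirectionalChainRule.
Context {R : realType} {V : normedModType R}.

Lemma is_derive_lineP (f : V -> R) (x v : V) (df : R) :
  is_derive x v f df <-> is_derive (0 : R) 1 (fun t : R => f (t *: v + x)) df.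
Proof.
have E : 'D_v f x = 'D_1 (fun t : R => f (t *: v + x)) 0.
  rewrite /derive; set g1 := fun h => h^-1 *: _; set g2 := fun h => h^-1 *: _.
  suff -> : g1 = g2 by [].
  rewrite funeqE /g1 /g2 => t /=.
  by rewrite addr0 scale0r add0r [_%:A]mulr1.
split=> -[H1 H2]; split.
- exact: (derivable1P f x v).1.
- by rewrite -E.
- exact: (derivable1P f x v).2.
- by rewrite E.
Qed.

(** Only derivability along the line through [x] is assumed of [f], so the
    statement reduces to the chain rule for functions of one variable. *)
Lemma is_derive_comp_line (f : V -> R) (h : R -> R) (x v : V) (df dh : R) :
  is_derive x v f df -> is_derive (f x) 1 h dh ->
  is_derive x v (h \o f) (dh * df).
Proof.
move=> /is_derive_lineP fx hfx; apply/is_derive_lineP.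
set l := fun t : R => f (t *: v + x) in fx *.
have El : f x = l 0 by rewrite /l scale0r add0r.
rewrite El in hfx; have lx := fx.
case: fx => dl <-; case: hfx => dh' <-.
rewrite -[fun t : R => _]/(h \o l) -!derive1E -derive1_comp//.
rewrite derive1E; apply: derivableP.
by apply/derivable1_diffP/differentiable_comp; exact/derivable1_diffP.
Qed.

End DirectionalChainRule.

Section SmoothClass.
Context {R : realType}.

(** The witness is the sequence of all the derivatives of [h]; only their values on
    [J] matter. *)
Definition smooth1 (J : set R) (h : R -> R) :=
  exists H : nat -> R -> R, H 0%N = h /\
    forall k x, J x -> is_derive x 1 (H k) (H k.+1 x).

Lemma is_derive1_continuous (h : R -> R) (x dh : R) :
  is_derive x 1 h dh -> {for x, continuous h}.
Proof. by case=> /derivable1_diffP/differentiable_continuous. Qed.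

Context {V : normedModType R} {I : Type} (e : I -> V).

(** A class of functions that contains everything that is built below and that is
    stable under differentiation along the directions [e i].  Taking the closure
    under sums, products and compositions as an inductive predicate makes this
    stability a plain structural induction ([smooth_fun_derive]) and avoids any
    formula for higher derivatives. *)
Inductive smooth_fun (D : set V) : (V -> R) -> Prop :=
| smooth_fun_affine f (g : I -> R) of continuous f &
    (forall i x, is_derive x (e i) f (g i)) : smooth_fun D f
| smooth_fun_add f g of smooth_fun D f & smooth_fun D g : smooth_fun D (fun x => f x + g x)
| smooth_fun_mul f g of smooth_fun D f & smooth_fun D g : smooth_fun D (fun x => f x * g x)
| smooth_fun_comp (J : set R) h f of smooth1 J h & (forall x, D x -> J (f x)) &
    smooth_fun D f : smooth_fun D (fun x => h (f x))
| smooth_fun_ext f g of (forall x, D x -> f x = g x) & smooth_fun D f : smooth_fun D g.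

Lemma smooth_fun_cst D c : smooth_fun D (fun=> c).
Proof.
by apply: (@smooth_fun_affine _ _ (fun=> 0)) => x; exact: cvg_cst.
Qed.

Lemma smooth_fun_sum D (J : Type) (r : seq J) (F : J -> V -> R) :
  (forall j, smooth_fun D (F j)) -> smooth_fun D (fun x => \sum_(j <- r) F j x).
Proof.
move=> FD; elim: r => [|j r IH].
  by apply: (smooth_fun_ext D (fun=> 0)) (smooth_fun_cst D 0) => x _; rewrite big_nil.
apply: (smooth_fun_ext D (fun x => F j x + \sum_(j <- r) F j x)) => [x _|].
  by rewrite big_cons.
exact: smooth_fun_add.
Qed.

Variable D : set V.
Hypothesis oD : open D.

Lemma smooth_fun_continuous f : smooth_fun D f -> forall x, D x -> {for x, continuous f}.
Proof.
elim=> {f} [f g fc _|f g _ fc _ gc|f g _ fc _ gc|J h f [H [<- hJ]] JD _ fc|f g fg _ fc] x Dx.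
- exact: fc.
- by apply: cvgD; [exact: fc|exact: gc].
- by apply: cvgM; [exact: fc|exact: gc].
- apply: continuous_comp; first exact: fc.
  exact: is_derive1_continuous (hJ 0%N _ (JD _ Dx)).
- have E : {near x, f =1 g}.
    by apply: filterS (open_nbhs_nbhs (conj oD Dx)) => y; exact: fg.
  rewrite /prop_for /continuous_at -(fg x Dx).
  by apply: cvg_trans (fc x Dx); apply: near_eq_cvg; exact: E.
Qed.

Lemma smooth_fun_derive f : smooth_fun D f ->
  forall i, exists2 g, smooth_fun D g & forall x, D x -> is_derive x (e i) f (g x).
Proof.
elim=> {f} [f g fc fd|f g _ IHf _ IHg|f g sf IHf sg IHg|J h f [H [<- hJ]] JD sf IHf|f g fg _ IHf] i.
- by exists (fun=> g i) => [|x _]; [exact: smooth_fun_cst|exact: fd].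
- have [f' ? fd] := IHf i; have [g' ? gd] := IHg i.
  exists (fun x => f' x + g' x) => [|x Dx]; first exact: smooth_fun_add.
  by have ? := fd x Dx; have ? := gd x Dx; apply: is_deriveD.
- have [f' ? fd] := IHf i; have [g' ? gd] := IHg i.
  exists (fun x => f x * g' x + g x * f' x) => [|x Dx].
    by apply: smooth_fun_add; apply: smooth_fun_mul.
  by have ? := fd x Dx; have ? := gd x Dx; apply: is_deriveM.
- have [f' ? fd] := IHf i.
  exists (fun x => H 1%N (f x) * f' x) => [|x Dx]; last first.
    exact: is_derive_comp_line (fd x Dx) (hJ 0%N _ (JD _ Dx)).
  apply: smooth_fun_mul => //; apply: (smooth_fun_comp D J (H 1%N) f) => //.
  by exists (fun k => H k.+1); split=> // k; exact: hJ.
- have [f' ? fd] := IHf i; exists f' => // x Dx.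
  apply: near_eq_is_derive (fd x Dx).
  by apply: filterS (open_nbhs_nbhs (conj oD Dx)) => y; exact: fg.
Qed.

End SmoothClass.

Section OneVariable.
Context {R : realType}.
Implicit Types (J : set R) (h : R -> R).

Definition smooth_fun1 J h := smooth_fun (fun _ : unit => 1 : R) J h.

(** The derivatives provided by [smooth_fun_derive] are chosen one after the
    other. *)
Lemma smooth_fun1_smooth1 J h : open J -> smooth_fun1 J h -> smooth1 J h.
Proof.
move=> oJ hJ.
have step (f : {f : R -> R | smooth_fun1 J f}) : {g : {g : R -> R | smooth_fun1 J g} |
    forall x, J x -> is_derive x 1 (projT1 f) (projT1 g x)}.
  case: f => f fJ; apply: cid.
  by have [g gJ fg] := smooth_fun_derive _ _ oJ _ fJ tt; exists (exist _ g gJ).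
pose H := fix H k := if k is k'.+1 then projT1 (step (H k')) else exist _ h hJ.
exists (fun k => projT1 (H k)); split=> // k x Jx.
exact: projT2 (step (H k)) x Jx.
Qed.

Lemma smooth_fun1_id J : smooth_fun1 J id.
Proof.
by apply: (@smooth_fun_affine _ _ _ _ _ _ (fun=> 1)) => x; exact: cvg_id.
Qed.

Lemma smooth1_smooth_fun1 J h : smooth1 J h -> smooth_fun1 J h.
Proof. by move=> hJ; apply: (smooth_fun_comp _ J J h id) hJ _ (smooth_fun1_id J). Qed.

Lemma smooth1_powR (a : R) : smooth1 [set x | 0 < x] (fun x => x `^ a).
Proof.
exists (fun k x => (\prod_(i < k) (a - i%:R)) * x `^ (a - k%:R)); split.
  by apply/funext => x; rewrite big_ord0 mul1r subr0.
move=> k x /= x0; rewrite big_ord_recr/= -mulrA.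
have := is_derive1_powR (a - k%:R) x0.
move=> /(is_deriveZ (\prod_(i < k) (a - i%:R))).
by rewrite -addrA -opprD natr1.
Qed.

End OneVariable.

(** * Partial derivatives and radial functions *)
Section EuclideanSpace.
Context {R : realType} {n : nat}.
Implicit Types (x y : 'rV[R]_n) (D : set 'rV[R]_n).

Definition basis (i : 'I_n) : 'rV[R]_n := delta_mx ord0 i.

Lemma smooth_fun_partials D f s : open D -> smooth_fun basis D f -> smooth_fun basis D (partials s f).
Proof.
move=> oD fD; elim: s => //= i s IH.
have [g gD fg] := smooth_fun_derive _ _ oD _ IH i.
apply: (smooth_fun_ext _ _ g) gD => x Dx.
by have [_ <-] := fg x Dx.
Qed.

Lemma smooth_fun_smooth_on D f : open D -> smooth_fun basis D f -> smooth_on D f.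
Proof.
move=> oD fD s x Dx; have sD := smooth_fun_partials D f s oD fD.
split; first exact: smooth_fun_continuous oD _ sD x Dx.
by move=> i; have [g _ /(_ x Dx)[]] := smooth_fun_derive _ _ oD _ sD i.
Qed.

Lemma is_derive_coord i j x :
  is_derive x (basis i) (fun y => y ord0 j) (j == i)%:R.
Proof.
apply/is_derive_lineP.
rewrite (_ : (fun t : R => _) = (fun t => (j == i)%:R * t + x ord0 j)); last first.
  by apply/funext => t; rewrite !mxE eqxx /= mulrC.
apply: is_derive_eq; rewrite addr0 /GRing.scale /= mulr1//.
Qed.

Lemma smooth_fun_coord D j : smooth_fun basis D (fun y => y ord0 j).
Proof.
apply: (@smooth_fun_affine _ _ _ _ _ _ (fun i => (j == i)%:R)) => [x|i x].
  exact: coord_continuous.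
exact: is_derive_coord.
Qed.

(** The squared distance is used throughout instead of the distance because it is
    smooth at the centre too. *)
Definition dist2 x y : R := \sum_(i < n) (x ord0 i - y ord0 i) ^+ 2.

Lemma dist2_ge0 x y : 0 <= dist2 x y.
Proof. by apply: sumr_ge0 => i _; rewrite sqr_ge0. Qed.

Lemma smooth_fun_dist2 D y : smooth_fun basis D (dist2 ^~ y).
Proof.
apply: smooth_fun_sum => i; have sD : smooth_fun basis D (fun x => x ord0 i - y ord0 i).
  by apply: smooth_fun_add; [exact: smooth_fun_coord|exact: smooth_fun_cst].
by apply: smooth_fun_ext (smooth_fun_mul _ _ _ _ sD sD) => x _; rewrite expr2.
Qed.

Lemma is_derive_dist2 y i x :
  is_derive x (basis i) (dist2 ^~ y) (2 * (x ord0 i - y ord0 i)).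
Proof.
have H j : is_derive x (basis i) (fun x => (x ord0 j - y ord0 j) ^+ 2)
   (2 * (x ord0 j - y ord0 j) * (j == i)%:R).
  have ? := is_derive_coord i j x.
  rewrite (_ : (fun x : 'rV_n => _) = ((fun x => x ord0 j) - cst (y ord0 j)) ^+ 2); last first.
    by apply/funext => z; rewrite !expr2.
  apply: is_derive_eq; rewrite subr0 /GRing.scale/=.
  by rewrite expr1.
rewrite (_ : dist2 ^~ y = \sum_(j < n) (fun x => (x ord0 j - y ord0 j) ^+ 2)); last first.
  by apply/funext => z; rewrite fct_sumE.
apply: is_derive_eq.
rewrite (bigD1 i)//= eqxx mulr1 big1 ?addr0// => j /negbTE ->.
by rewrite mulr0.
Qed.

Section Radial.
Variables (J : set R) (h h1 h2 : R -> R) (y : 'rV[R]_n).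
Hypothesis hJ : forall x, J (dist2 x y).
Hypothesis dh : forall t, J t -> is_derive t 1 h (h1 t).
Hypothesis dh1 : forall t, J t -> is_derive t 1 h1 (h2 t).

Lemma is_derive_radial i x : is_derive x (basis i) (fun x => h (dist2 x y))
  (h1 (dist2 x y) * (2 * (x ord0 i - y ord0 i))).
Proof. exact: is_derive_comp_line (is_derive_dist2 y i x) (dh _ (hJ x)). Qed.

Lemma is_derive2_radial i x :
  is_derive x (basis i) (partial i (fun x => h (dist2 x y)))
  (4 * (x ord0 i - y ord0 i) ^+ 2 * h2 (dist2 x y) + 2 * h1 (dist2 x y)).
Proof.
have -> : partial i (fun x => h (dist2 x y)) =
    (fun x => h1 (dist2 x y)) * (2 *: ((fun x => x ord0 i) - cst (y ord0 i))).
  by apply/funext => z; have [_] := is_derive_radial i z.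
have ? := is_derive_coord i i x.
have ? := is_derive_comp_line _ _ _ _ _ _ (is_derive_dist2 y i x) (dh1 _ (hJ x)).
apply: is_derive_eq; rewrite eqxx subr0 /GRing.scale/= /GRing.scale/= !fctE.
by ring.
Qed.

(** For a function of [s = |x - y| ^ 2]: [d_i] gives [2 (x_i - y_i) h'(s)], then
    [4 (x_i - y_i) ^ 2 h''(s) + 2 h'(s)], to be summed over [i]. *)
Lemma laplacian_radial x : laplacian (fun x => h (dist2 x y)) x =
  4 * dist2 x y * h2 (dist2 x y) + 2 * n%:R * h1 (dist2 x y).
Proof.
rewrite /laplacian (eq_bigr _ (fun i _ => @derive_val _ _ _ _ _ _ _ (is_derive2_radial i x))).
rewrite big_split/= -mulr_suml -mulr_sumr; congr (_ + _).
by rewrite sumr_const card_ord -mulr_natr; ring.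
Qed.

End Radial.

End EuclideanSpace.

(** * A smooth cutoff *)
Section Cutoff.
Context {R : realType}.

(** The class of the functions [P(1/t) exp(-1/t)], extended by 0 to [t <= 0], is
    stable under differentiation, so that all derivatives of [exp(-1/t)] are
    handled at once. *)
Definition flat (P : {poly R}) (t : R) : R :=
  if 0 < t then P.[t^-1] * expR (- t^-1) else 0.

Lemma horner_le_pow (P : {poly R}) : exists2 A, 0 <= A &
  forall x, 1 <= x -> `|P.[x]| <= A * x ^+ size P.
Proof.
exists (\sum_(i < size P) `|P`_i|); first exact: sumr_ge0.
move=> x x1; rewrite horner_coef (le_trans (ler_norm_sum _ _ _))//.
rewrite mulr_suml; apply: ler_sum => i _.
rewrite normrM ler_wpM2l// ger0_norm ?exprn_ge0 ?(le_trans ler01)//.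
by apply: ler_weXn2l => //; apply/ltnW.
Qed.

(** With [x = 1/t >= 1], [exp x] dominates [x ^ (d + 2) / (d + 2)!] for
    [d = size P]. *)
Lemma flat_le (P : {poly R}) : exists2 A, 0 <= A &
  forall t, `|t| <= 1 -> `|flat P t| <= A * t ^+ 2.
Proof.
have [A A0 PA] := horner_le_pow P.
exists (A * (size P).+2`!%:R) => [|t t1]; first by rewrite mulr_ge0.
rewrite /flat; case: ifP => [t0|_]; last first.
  by rewrite normr0 mulr_ge0 ?sqr_ge0// mulr_ge0.
have {t1} : t <= 1 by apply: le_trans t1; exact: ler_norm.
set x := t^-1 => t1.
have x1 : 1 <= x by rewrite invf_ge1.
have x0 : 0 < x by rewrite (lt_le_trans ltr01).
have -> : t = x^-1 by rewrite /x invrK.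
rewrite normrM [`|expR _|]ger0_norm ?expR_ge0// expRN.
have fac : 0 < (size P).+2`!%:R :> R by rewrite ltr0n fact_gt0.
have ex : x ^+ (size P).+2 / (size P).+2`!%:R <= expR x.
  by rewrite (le_trans _ (expR_ge1Dxn (size P).+1 (ltW x0)))// lerDr.
rewrite ler_pdivrMr ?expR_gt0//.
apply: le_trans (PA _ x1) _.
apply: (@le_trans _ _ (A * (size P).+2`!%:R * x^-1 ^+ 2 * (x ^+ (size P).+2 / (size P).+2`!%:R))).
  rewrite le_eqVlt; apply/orP; left; apply/eqP.
  rewrite -addn2 exprD; field.
  by rewrite (gt_eqF x0) andbT addn2 (gt_eqF fac).
by rewrite ler_wpM2l// mulr_ge0 ?sqr_ge0// mulr_ge0// ltW.
Qed.

(** The derivative of [P(1/t) exp(-1/t)] is [(P - P')(1/t) t ^ (-2) exp(-1/t)]; at 0 the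
    quadratic bound [flat_le] gives the derivative 0. *)
Lemma is_derive_flat (P : {poly R}) (t : R) :
  is_derive t 1 (flat P) (flat ('X^2 * (P - P^`())) t).
Proof.
have [t0|t0|->] := ltgtP t 0.
- rewrite {2}/flat ltNge (ltW t0)/=.
  apply: (@near_eq_is_derive _ _ _ (cst 0)).
  near=> z; rewrite /flat ltNge ltW//=; near: z; exact: lt_nbhsl.
- rewrite {2}/flat t0.
  apply: (@near_eq_is_derive R R R (fun t : R => P.[t^-1] * expR (- t^-1))).
    by near=> z; rewrite /flat ifT//; near: z; exact: lt_nbhsr.
  have tn0 : id t != 0 by rewrite gt_eqF.
  have dV : is_derive t 1 (fun t : R => t^-1) (- t ^- 2).
    by apply: is_derive_eq (is_deriveV tn0 (is_derive_id t 1)) _; rewrite /GRing.scale/= mulr1.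
  have dP := is_derive_comp_line _ _ _ _ _ _ dV (is_derive_poly P (t^-1)).
  have dN := is_derive_comp_line _ _ _ _ _ _ (is_deriveN dV) (is_derive_expR (- t^-1)).
  apply: is_derive_eq (is_deriveM dP dN) _.
  rewrite /GRing.scale/= !hornerE/=. field; exact: tn0.
- have [A A0 fA] := flat_le P.
  have f0 : flat P 0 = 0 by rewrite /flat ltxx.
  suff H : h^-1 *: ((flat P \o shift 0) (h *: (1 : R)) - flat P 0) @[h --> 0^'] --> (0 : R).
    split; first by apply/cvg_ex; exists 0.
    by rewrite /flat ltxx; apply/cvg_lim.
  apply/cvgr0Pnorm_le => e e0 /=.
  have dlt : 0 < Num.min 1 (e / (A + 1)).
    by rewrite lt_min ltr01/= divr_gt0// ltr_wpDl.
  near=> h.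
  have h0 : h != 0 by near: h; exact: nbhs_dnbhs_neq.
  have hd : `|h| <= Num.min 1 (e / (A + 1)).
    by near: h; apply: dnbhs0_le.
  move: hd; rewrite le_min => /andP[h1 he].
  rewrite f0 subr0 addr0 [h *: 1]mulr1 [h^-1 *: _]mulrC normrM normfV.
  rewrite ler_pdivrMr ?normr_gt0//.
  apply: le_trans (fA h h1) _.
  rewrite -real_normK ?num_real// expr2 mulrA ler_wpM2r//.
  rewrite -[e](@divfK _ (A + 1)); last by rewrite gt_eqF// ltr_wpDl.
  rewrite mulrC; apply: ler_pM => //.
  by rewrite lerDl.
Unshelve. all: by end_near. Qed.

Lemma smooth1_flat (P : {poly R}) : smooth1 setT (flat P).
Proof.
exists (fun k => flat (iter k (fun P => 'X^2 * (P - P^`())) P)); split=> //.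
by move=> k x _; rewrite iterS; exact: is_derive_flat.
Qed.

Lemma flat1_gt0 t : 0 < t -> 0 < flat 1 t.
Proof. by rewrite /flat => ->; rewrite hornerE mul1r expR_gt0. Qed.

Lemma flat_le0 P t : t <= 0 -> flat P t = 0.
Proof. by rewrite /flat leNgt => /negbTE ->. Qed.

Lemma flat1_ge0 t : 0 <= flat 1 t.
Proof. by have [/flat_le0 ->|/flat1_gt0/ltW] := leP t 0. Qed.

Lemma cutoff_exists : exists c : R -> R,
  [/\ smooth1 setT c, forall t, 0 <= c t <= 1, forall t, t <= 0 -> c t = 1 &
      forall t, 1 <= t -> c t = 0].
Proof.
pose d t := flat 1 (1 - t) + flat 1 t.
have d0 t : 0 < d t.
  rewrite /d; have [t0|t0] := leP t 0.
    by rewrite ltr_pwDl ?flat1_ge0 ?flat1_gt0//; lra.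
  by rewrite ltr_wpDl ?flat1_ge0 ?flat1_gt0.
exists (fun t => flat 1 (1 - t) / d t); split.
- apply: smooth_fun1_smooth1; first exact: openT.
  have s1 : smooth_fun1 setT (fun t : R => flat 1 (1 - t)).
    apply: (smooth_fun_comp _ _ setT (flat 1) (fun t : R => 1 - t)) => //.
      exact: smooth1_flat.
    have s0 := smooth_fun_mul _ _ _ _ (smooth_fun_cst _ setT (-1)) (smooth_fun1_id setT).
    apply: (smooth_fun_ext _ _ (fun x : R => 1 + -1 * x)) => [x _|]; first by rewrite mulN1r.
    by apply: (smooth_fun_add _ _ (fun=> 1) (fun x : R => -1 * x)) => //; exact: smooth_fun_cst.
  apply: smooth_fun_mul => //.
  apply: (smooth_fun_ext _ _ (fun t : R => (d t) `^ (-1))) => [t _|].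
    by rewrite powR_inv1// ltW.
  apply: (smooth_fun_comp _ _ [set x : R | 0 < x] (fun x : R => x `^ (-1)) d) => //.
    exact: smooth1_powR.
  - by move=> x _; exact: d0.
  by apply: (smooth_fun_add _ _ (fun t : R => flat 1 (1 - t)) (flat 1)) => //; apply: smooth1_smooth_fun1; exact: smooth1_flat.
- move=> t; rewrite divr_ge0 ?flat1_ge0 ?(ltW (d0 t))//=.
  by rewrite ler_pdivrMr// mul1r lerDl flat1_ge0.
- move=> t t0; rewrite /d (flat_le0 _ t)// addr0 divff// gt_eqF// flat1_gt0//.
  by lra.
- by move=> t t1; rewrite flat_le0 ?mul0r//; lra.
Qed.

End Cutoff.

(** * Weierstrass approximation *)
Section Weierstrass.
Context {R : realType}.
Implicit Types (f : R -> R) (phi psi : nat -> R).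

Lemma heine_cantor f (a b : R) :
  (forall x, a <= x <= b -> {for x, continuous f}) ->
  forall e, 0 < e -> exists2 d, 0 < d & forall x y, a <= x <= b -> a <= y <= b ->
    `|x - y| < d -> `|f x - f y| < e.
Proof.
move=> fc e e0.
have := @segment_compact R a b; rewrite compact_near_coveringP.
move=> /(_ _ _ (fun d x => forall y, `|x - y| < d -> `|f x - f y| < e)
  (at_right_proper_filter (0 : R))).
case.
  move=> x; rewrite /= in_itv/= => xab.
  have e2 : 0 < e / 2 by rewrite divr_gt0.
  have /cvgrPdist_lt/(_ _ e2)/nbhs_ballP[r /= r0 xr] := fc x xab.
  have r2 : 0 < r / 2 by rewrite divr_gt0.
  exists (ball x (r / 2), [set d | d < r / 2]).
    split; first exact: nbhsx_ballx.
    exact: nbhs_right_lt.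
  move=> [z d] /= [xz dr] y zy.
  have H1 : `|f x - f z| < e / 2.
    by apply: xr; apply: le_ball xz; lra.
  have H2 : `|f x - f y| < e / 2.
    apply: xr; rewrite /ball/= -(subrK z x) -addrA (le_lt_trans (ler_normD _ _))//.
    by rewrite [r]splitr ltrD// (lt_trans zy).
  rewrite -(subrK (f x) (f z)) -addrA (le_lt_trans (ler_normD _ _))//.
  by rewrite [e]splitr ltrD// distrC.
move=> d /= d0 H; exists (d / 2) => [|x y xab yab xy]; first by rewrite divr_gt0.
apply: (H (d / 2)) => //=; rewrite ?in_itv//= ?divr_gt0//.
by rewrite sub0r normrN ger0_norm ?divr_ge0 ?ltW// ltr_pdivrMr// ltr_pMr// ltr1n.
Qed.

(** The value at [x] is the expectation of [phi] at a binomial variable of parameters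
    [k] and [x].  The recursion conditions on one trial; it gives the expectation of
    the first moments by induction, without binomial coefficients. *)
Fixpoint bernstein k phi : {poly R} :=
  if k is k'.+1 then
    (1 - 'X) * bernstein k' phi + 'X * bernstein k' (fun i => phi i.+1)
  else (phi 0%N)%:P.

Lemma bernsteinS k phi x : (bernstein k.+1 phi).[x] =
  (1 - x) * (bernstein k phi).[x] + x * (bernstein k (fun i => phi i.+1)).[x].
Proof. by rewrite /= !hornerE. Qed.

Lemma bernsteinD k phi psi x : (bernstein k (fun i => phi i + psi i)).[x] =
  (bernstein k phi).[x] + (bernstein k psi).[x].
Proof.
elim: k phi psi => [|k IH] phi psi; first by rewrite /= !hornerE.
by rewrite !bernsteinS !IH; ring.
Qed.

Lemma bernsteinZ k (c : R) phi x : (bernstein k (fun i => c * phi i)).[x] =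
  c * (bernstein k phi).[x].
Proof.
elim: k phi => [|k IH] phi; first by rewrite /= !hornerE.
by rewrite !bernsteinS !IH; ring.
Qed.

Lemma bernstein_cst k (c x : R) : (bernstein k (fun=> c)).[x] = c.
Proof.
elim: k => [|k IH]; first by rewrite /= !hornerE.
by rewrite !bernsteinS !IH; ring.
Qed.

Lemma bernstein_le k phi psi x : 0 <= x <= 1 ->
  (forall i, (i <= k)%N -> phi i <= psi i) ->
  (bernstein k phi).[x] <= (bernstein k psi).[x].
Proof.
move=> x01; elim: k phi psi => [|k IH] phi psi H.
  by rewrite /= !hornerE H.
rewrite !bernsteinS lerD// ler_wpM2l ?subr_ge0//; try by case/andP: x01.
- by apply: IH => i ik; rewrite H// ltnW.
- by apply: IH => i ik; rewrite H.
Qed.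

(** The mean squared deviation from an arbitrary [c], not only from the mean
    [k x], because a success shifts [c] by one in the induction. *)
Lemma bernstein_variance k (c x : R) :
  (bernstein k (fun i => (i%:R - c) ^+ 2)).[x] =
  (k%:R * x - c) ^+ 2 + k%:R * (x * (1 - x)).
Proof.
elim: k c => [|k IH] c; first by rewrite /= !hornerE/=; ring.
rewrite bernsteinS; cbv beta.
have -> : (fun i : nat => (i.+1%:R - c) ^+ 2) = (fun i => (i%:R - (c - 1)) ^+ 2).
  by apply/funext => i; rewrite -natr1; congr (_ ^+ _); ring.
by rewrite !IH -natr1; ring.
Qed.

(** Bernstein's proof: [|f(i/N) - f(x)|] is at most [e / 2] if [i/N] is within [d] of
    [x], and at most [2 M (i/N - x) ^ 2 / d ^ 2] otherwise; the variance of [i/N] is at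
    most [1/N]. *)
Lemma weierstrass_approximation f :
  (forall x, 0 <= x <= 1 -> {for x, continuous f}) -> forall e, 0 < e ->
  exists P : {poly R}, forall x, 0 <= x <= 1 -> `|P.[x] - f x| <= e.
Proof.
move=> fc e e0.
have [M M0 fM] : exists2 M, 0 < M & forall x, 0 <= x <= 1 -> `|f x| <= M.
  have [|c _ cM] := @EVT_max R (fun x => `|f x|) 0 1 ler01.
    apply: continuous_in_subspaceT => x; rewrite inE/= in_itv/= => x01.
    by apply: continuous_comp; [exact: fc|exact: norm_continuous].
  exists (`|f c| + 1) => [|x x01]; first by rewrite ltr_wpDl.
  by rewrite (le_trans (cM x _)) ?lerDl// in_itv.
have e2 : 0 < e / 2 by rewrite divr_gt0.
have [d d0 fd] := heine_cantor f 0 1 fc (e / 2) e2.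
(* Chosen so that 2 M / (d ^ 2 N) <= e / 2. *)
pose N := (Num.truncn (4 * M / (d ^+ 2 * e))).+1.
have N0 : 0 < N%:R :> R by rewrite ltr0n.
have NM : 4 * M / (d ^+ 2 * e) <= N%:R by rewrite ltW// truncnS_gt.
exists (bernstein N (fun i => f (i%:R / N%:R))) => x x01.
pose psi i := e / 2 + 2 * M / (d ^+ 2 * N%:R ^+ 2) * ((i%:R - N%:R * x) ^+ 2).
have psiE : (bernstein N psi).[x] <= e.
  rewrite bernsteinD bernstein_cst bernsteinZ bernstein_variance subrr expr0n add0r.
  rewrite [leRHS]splitr lerD2l.
  apply: (@le_trans _ _ (2 * M / (d ^+ 2 * N%:R))).
    rewrite [leLHS](_ : _ = 2 * M / (d ^+ 2 * N%:R) * (x * (1 - x))); last first.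
      by field; rewrite (gt_eqF N0) (gt_eqF d0).
    rewrite ler_piMr//.
      by rewrite divr_ge0 ?mulr_ge0// ltW.
    by nra.
  rewrite ler_pdivrMr; last by rewrite mulr_gt0// exprn_gt0.
  move: NM; rewrite ler_pdivrMr; last by rewrite mulr_gt0// exprn_gt0.
  by nra.
have key i : (i <= N)%N -> `|f (i%:R / N%:R) - f x| <= psi i.
  move=> iN.
  have i01 : 0 <= (i%:R / N%:R : R) <= 1.
    by rewrite divr_ge0//= ler_pdivrMr// mul1r ler_nat.
  have q0 : 0 <= 2 * M / (d ^+ 2 * N%:R ^+ 2) * ((i%:R - N%:R * x) ^+ 2).
    by rewrite mulr_ge0 ?sqr_ge0// divr_ge0 ?mulr_ge0 ?sqr_ge0// ltW.
  have [xd|xd] := ltP `|i%:R / N%:R - x| d.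
    by apply: (@le_trans _ _ (e / 2)); [exact/ltW/fd|rewrite lerDl].
  apply: (@le_trans _ _ (2 * M)).
    by have := fM _ i01; have := fM _ x01;
      have := ler_normB (f (i%:R / N%:R)) (f x); lra.
  rewrite /psi ler_wpDl//; first exact: ltW.
  rewrite [leRHS](_ : _ = 2 * M * ((i%:R / N%:R - x) ^+ 2 / d ^+ 2)); last first.
    by field; rewrite (gt_eqF N0) (gt_eqF d0).
  rewrite ler_peMr//; first by rewrite mulr_ge0// ltW.
  rewrite ler_pdivlMr ?exprn_gt0// mul1r -[X in _ <= X]real_normK ?num_real//.
  by rewrite lerXn2r// nnegrE// ltW.
rewrite ler_norml; apply/andP; split.
  rewrite lerBrDl -(bernstein_cst N (f x) x) -[- e]mulN1r.
  apply: (@le_trans _ _ (bernstein N (fun i => f x + -1 * psi i)).[x]).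
    by rewrite bernsteinD bernsteinZ lerD2l ler_nM2l// ltrN10.
  apply: bernstein_le => // i iN; have := key i iN.
  by rewrite ler_norml => /andP[]; lra.
rewrite lerBlDl -(bernstein_cst N (f x) x).
apply: (@le_trans _ _ (bernstein N (fun i => f x + psi i)).[x]).
  apply: bernstein_le => // i iN; have := key i iN.
  by rewrite ler_norml => /andP[]; lra.
by rewrite bernsteinD lerD2l.
Qed.

End Weierstrass.

(** * Real powers *)
Section Powers.
Context {R : realType}.
Implicit Types (a m p x y t : R).

Lemma powR_le2 p x y : 0 < p -> 0 <= x -> x <= y -> x `^ p <= y `^ p.
Proof.
move=> p0 x0 xy; have y0 := le_trans x0 xy.
exact: ge0_ler_powR (ltW p0) _ _ x0 y0 xy.
Qed.

(** Continuity of the power at 1, in the homogeneous form in which it is used: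
    a small relative error on the base gives a small relative error on the
    power. *)
Lemma powR_close p : 0 < p -> forall e, 0 < e -> exists d, 0 < d < 1 /\
  forall x y, 0 <= y -> `|x - y| <= d * y -> `|x `^ p - y `^ p| <= e * y `^ p.
Proof.
move=> p0 e e0.
have c1 : {for 1, continuous (fun t => t `^ p)}.
  exact: is_derive1_continuous (is_derive1_powR p (@ltr01 R)).
have /cvgrPdist_le/(_ _ e0)/nbhs_ballP[d /= d0 dP] := c1.
exists (Num.min (d / 2) (1 / 2)); split.
  by rewrite lt_min gt_min; apply/andP; split; lra.
move=> x y; rewrite le_eqVlt => /predU1P[<-|y0 xy].
  by rewrite mulr0 subr0 normr_le0 => /eqP ->; rewrite subrr normr0 mulr_ge0 ?powR_ge0// ltW.
have [xyd xy1] : `|x - y| <= d / 2 * y /\ `|x - y| <= 1 / 2 * y.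
  by split; apply: le_trans xy _; rewrite (ler_wpM2r (ltW y0))// ge_min lexx ?orbT.
have x0 : 0 <= x by move: xy1; rewrite ler_norml => /andP[]; lra.
have -> : x = (x / y) * y by rewrite divfK// gt_eqF.
have y0W := ltW y0; rewrite powRM ?divr_ge0// -[X in _ - X]mul1r -mulrBl normrM.
rewrite [`|y `^ p|]ger0_norm ?powR_ge0// ler_wpM2r ?powR_ge0//.
rewrite distrC; have := dP (x / y); rewrite powR1; apply.
rewrite /ball/= -[X in `|X - _|](divff (lt0r_neq0 y0)) -mulrBl normrM normfV.
rewrite [`|y|]gtr0_norm// ltr_pdivrMr// distrC (le_lt_trans xyd)//.
by rewrite ltr_pM2r//; lra.
Qed.

Lemma powR_le_root p e t : 0 < p -> 0 <= e -> 0 <= t ->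
  t <= e `^ p^-1 -> t `^ p <= e.
Proof.
move=> p0 e0 t0 te; rewrite -[leRHS](powRr1 e0) -[X in _ <= _ `^ X](mulVf (lt0r_neq0 p0)) powRrM.
by rewrite ge0_ler_powR// ?nnegrE ?powR_ge0 ?ltW.
Qed.

(** The maximum is there because the power of a negative number is 1 by
    convention, which would break continuity at 0. *)
Lemma continuous_powR_max p : 0 < p -> continuous (fun t => Num.max t 0 `^ p).
Proof.
move=> p0 t; have [t0|t0|->] := ltgtP t 0.
- apply: (@near_cst_continuous _ _ 0); near=> s.
  rewrite max_r ?powR0 ?gt_eqF// ltW//.
  by near: s; exact: lt_nbhsl.
- have c1 : {for t, continuous (fun t => t `^ p)}.
    exact: is_derive1_continuous (is_derive1_powR p t0).
  rewrite /continuous_at (max_l (ltW t0)); apply: cvg_trans c1.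
  apply: near_eq_cvg; near=> s; rewrite max_l// ltW//.
  by near: s; exact: lt_nbhsr.
- rewrite /continuous_at max_l// powR0 ?gt_eqF//.
  apply/cvgr0Pnorm_le => e e0.
  have d0 : 0 < e `^ p^-1 by rewrite powR_gt0.
  exists (e `^ p^-1) => //= s sd0; have sd : `|s| < e `^ p^-1 by rewrite -normrN -(sub0r s).
  rewrite ger0_norm ?powR_ge0//; apply: powR_le_root => //; first exact: ltW.
    by rewrite le_max lexx orbT.
  by rewrite ge_max powR_ge0 andbT (le_trans (ler_norm _))// ltW.
Unshelve. all: by end_near. Qed.

Lemma continuous_powR_comp (f : R -> R) p x : {for x, continuous f} -> 0 < f x ->
  {for x, continuous (fun y => f y `^ p)}.
Proof.
move=> fc fx; apply: (@continuous_comp _ _ _ f (fun t => t `^ p)) => //.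
exact: is_derive1_continuous (is_derive1_powR p fx).
Qed.

End Powers.

(** * Approximation of the interaction term *)
Section Interaction.
Context {R : realType}.
Variables (a m p : R).

Definition interaction (T : R) : R := (a + T) `^ p - a `^ p - T `^ p.

Lemma interaction_small_at_infinity : 0 < a -> 0 < p -> forall e, 0 < e -> exists2 T1, 0 < T1 &
  forall T, T1 <= T -> `|interaction T| <= e * (a + T) `^ p.
Proof.
move=> a0 p0 e e0; have e2 : 0 < e / 2 by rewrite divr_gt0.
have [d [/andP[d0 _] dP]] := powR_close p p0 (e / 2) e2.
pose b := (e / 2) `^ p^-1; have b0 : 0 < b by rewrite powR_gt0.
exists (a / d + a / b) => [|T TT]; first by rewrite addr_gt0 ?divr_gt0.
have ad0 : 0 < a / d by rewrite divr_gt0.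
have ab0 : 0 < a / b by rewrite divr_gt0.
have Td : a <= d * T by rewrite mulrC -ler_pdivrMr//; lra.
have Tb : a <= b * T by rewrite mulrC -ler_pdivrMr//; lra.
have T0 : 0 <= T by lra.
have TaT : T `^ p <= (a + T) `^ p.
  by apply: powR_le2 => //; lra.
have H1 : `|(a + T) `^ p - T `^ p| <= e / 2 * T `^ p.
  by apply: dP => //; rewrite addrK gtr0_norm.
have H2 : a `^ p <= e / 2 * T `^ p.
  have -> : e / 2 = b `^ p.
    by rewrite -powRrM mulVf ?lt0r_neq0// powRr1// ltW.
  rewrite -powRM//; last exact: ltW.
  by apply: powR_le2 => //; lra.
have := ler_wpM2l (ltW e2) TaT; have := powR_ge0 a p.
rewrite /interaction addrAC; move: H1; rewrite !ler_norml => /andP[].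
by lra.
Qed.

Definition capped_interaction (t : R) : R := interaction (Num.max t 0 `^ m).

Lemma continuous_capped_interaction : 0 < a -> 0 < m -> 0 < p ->
  continuous capped_interaction.
Proof.
move=> a0 m0 p0 t; have mc := continuous_powR_max m m0 t.
have mc0 : 0 <= Num.max t 0 `^ m by exact: powR_ge0.
rewrite /capped_interaction /interaction.
apply: cvgB; first apply: cvgB.
- apply: (continuous_powR_comp (fun t => a + Num.max t 0 `^ m)).
    by apply: cvgD; [exact: cvg_cst|exact: mc].
  by rewrite ltr_pwDl.
- exact: cvg_cst.
- rewrite (_ : (fun x => _) = fun x => Num.max x 0 `^ (m * p)).
    by rewrite -powRrM; apply: continuous_powR_max; rewrite mulr_gt0.
  by apply/funext => s; rewrite powRrM.
Qed.

Lemma capped_interaction0 : 0 < m -> 0 < p -> capped_interaction 0 = 0.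
Proof.
move=> m0 p0.
rewrite /capped_interaction /interaction maxxx powR0 ?lt0r_neq0//.
by rewrite powR0 ?lt0r_neq0// addr0 subrr subr0.
Qed.

Lemma dist_max_le (x l q : R) : 0 <= l ->
  `|Num.max (l + x) q - Num.max x q| <= l.
Proof.
move=> l0; rewrite ler_norml; apply/andP.
by split; case: (leP (l + x) q); case: (leP x q); lra.
Qed.

(** Replacing [1/x] by [min(1/x, L)] is harmless: beyond [L] both interaction terms
    are within the tolerance. *)
Lemma cap_error (e L x : R) : 0 < a -> 0 < m -> 0 < p -> 0 <= e -> 0 < L ->
  (forall T, L `^ m <= T -> `|interaction T| <= e * (a + T) `^ p) -> 0 < x ->
  `|capped_interaction (Num.max x L^-1)^-1 - interaction (x^-1 `^ m)| <=
    2 * e * (a + x^-1 `^ m) `^ p.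
Proof.
move=> a0 m0 p0 e0 L0 LP x0.
have mx0 : 0 < Num.max x L^-1 by rewrite lt_max x0.
rewrite /capped_interaction (max_l (_ : 0 <= (Num.max x L^-1)^-1)); last first.
  by rewrite invr_ge0 ltW.
have [Lx|xL] := leP L^-1 x.
  by rewrite subrr normr0 !mulr_ge0// powR_ge0.
rewrite invrK; set T := x^-1 `^ m.
have LT : L `^ m <= T.
  apply: (powR_le2 _ _ _ m0 (ltW L0)).
  by rewrite -[L]invrK lef_pV2 ?posrE ?invr_gt0// ltW.
have I1 := LP _ (lexx _); have I2 := LP _ LT.
have I3 : (a + L `^ m) `^ p <= (a + T) `^ p.
  by apply: powR_le2 => //; rewrite ?lerD2l// addr_ge0 ?powR_ge0// ltW.
move: I1 I2 (ler_wpM2l e0 I3) (ler_normB (interaction (L `^ m)) (interaction T)).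
move: (interaction T) (interaction (L `^ m)) => u v.
move: ((a + T) `^ p) ((a + L `^ m) `^ p) => b c.
move: `|u| `|v| `|v - u|; clear; move=> *; lra.
Qed.

(** Here [y = |x| ^ 2 / l], [z = 1 / (1 + y)] and [T] is the bubble.  As [l] tends to 0,
    [1 / (l + y)] tends to [1 / y = z / (1 - z)], a function of [z] that does not depend on
    [l].  It is capped at a large level [L], the resulting continuous function of [z]
    is divided by [z ^ (m + 2)] and approximated by a polynomial.  The quotient is
    singular only at [z = 0], where the interaction vanishes, so the denominator may
    be frozen below some [z0].  The error splits into four parts: the polynomial
    approximation, the frozen denominator, the replacement of [l + y] by [y], and the
    cap. *)
Lemma interaction_approx : 0 < a -> 0 < m -> 0 < p -> forall e, 0 < e ->
  exists (Q : {poly R}), exists2 l1, 0 < l1 &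
  forall l y, 0 < l < l1 -> 0 <= y ->
    let z := (1 + y)^-1 in let T := (l + y)^-1 `^ m in
    `|z `^ (m + 2) * Q.[z] - interaction T| <= e * (a + T) `^ p.
Proof.
move=> a0 m0 p0 e e0; have cc := continuous_capped_interaction a0 m0 p0.
pose k := e * a `^ p / 8.
have ap0 : 0 < a `^ p by rewrite powR_gt0.
have k0 : 0 < k by rewrite /k; have := mulr_gt0 e0 ap0; lra.
have e4 : 0 < e / 4 by rewrite divr_gt0.
have [T1 T10 TP] := interaction_small_at_infinity a0 p0 _ e4.
pose L := T1 `^ m^-1.
have L0 : 0 < L by rewrite powR_gt0.
have LT : L `^ m = T1 by rewrite -powRrM mulVf ?lt0r_neq0// powRr1// ltW.
pose q := L^-1; have q0 : 0 < q by rewrite invr_gt0.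
(* For z = 1 / (1 + y) the quotient z / den z is 1 / max(y, 1 / L). *)
pose den z := Num.max (1 - z) (q * z).
have den0 z : 0 < den z.
  rewrite /den lt_max; have [z1|z1] := ltP z 1; first by rewrite subr_gt0 z1.
  by rewrite mulr_gt0 ?orbT// (lt_le_trans ltr01).
have idc z : {for z, continuous (id : R -> R)} by exact: cvg_id.
have denc z : {for z, continuous den}.
  apply: continuous_max; first by apply: cvgB; [exact: cvg_cst|exact: idc].
  by apply: cvgM; [exact: cvg_cst|exact: idc].
pose zL z := z / den z.
have zLc z : {for z, continuous zL}.
  apply: cvgM; first exact: idc.
  by apply: cvgV; [rewrite lt0r_neq0|exact: denc].
pose H z := capped_interaction (zL z).
have Hc z : {for z, continuous H}.
  by apply: (@continuous_comp _ _ _ zL); [exact: zLc|exact: cc].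
have [z0 /andP[z00 z01] Hz0] : exists2 z0, 0 < z0 < 1 & forall z, 0 <= z <= z0 -> `|H z| <= k.
  have H0 : H 0 = 0 by rewrite /H /zL mul0r capped_interaction0.
  have /cvgrPdist_le/(_ _ k0)/nbhs_ballP[d /= d0 dP] := Hc 0.
  exists (Num.min (d / 2) (1 / 2)).
    by rewrite lt_min gt_min; apply/andP; split; lra.
  move=> z; rewrite le_min => /and3P[z0 zd _].
  have := dP z; rewrite /= H0 sub0r normrN; apply.
  by rewrite /ball/= sub0r normrN ger0_norm//; lra.
pose M z := Num.max z z0 `^ (m + 2).
have M0 z : 0 < M z by rewrite powR_gt0// lt_max z00 orbT.
have m2 : 0 < m + 2 by rewrite addr_gt0.
have hc z : 0 <= z <= 1 -> {for z, continuous (fun z => H z / M z)}.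
  move=> _; apply: cvgM; first exact: Hc.
  apply: cvgV; first by rewrite lt0r_neq0.
  apply: (continuous_powR_comp (fun z => Num.max z z0)).
    by apply: continuous_max; [exact: idc|exact: cvg_cst].
  by rewrite lt_max z00 orbT.
have [Q QP] := weierstrass_approximation _ hc k k0.
have [d d0 dP] := heine_cantor capped_interaction 0 L
  (fun x _ => cc x) k k0.
exists Q, (d * q ^+ 2); first by rewrite mulr_gt0// exprn_gt0.
move=> l y /andP[l0 ll1] y0; cbv zeta.
set z := (1 + y)^-1.
have y1 : 0 < 1 + y by lra.
have zp : 0 < z by rewrite invr_gt0.
have z1 : z <= 1 by rewrite invf_le1//; lra.
have z01' : 0 <= z <= 1 by rewrite ltW.
have zM1 : z `^ (m + 2) <= 1.
  by apply: le_trans (powR_le2 _ _ _ m2 (ltW zp) z1) _; rewrite powR1.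
have S1 : `|z `^ (m + 2) * Q.[z] - z `^ (m + 2) * (H z / M z)| <= k.
  rewrite -mulrBr normrM ger0_norm ?powR_ge0// -[leRHS]mul1r.
  by apply: ler_pM => //; [exact: powR_ge0|exact: QP].
have S2 : `|z `^ (m + 2) * (H z / M z) - H z| <= k.
  have [zz0|zz0] := leP z0 z.
    by rewrite /M max_l// mulrCA divff ?mulr1 ?subrr ?normr0 1?ltW// lt0r_neq0// powR_gt0.
  have Hk : `|H z| <= k by apply: Hz0; rewrite !ltW.
  apply: le_trans Hk.
  have MzE : M z = z0 `^ (m + 2) by rewrite /M max_r// ltW.
  have th1 : z `^ (m + 2) / M z <= 1.
    by rewrite ler_pdivrMr// mul1r MzE; apply: powR_le2 => //; exact: ltW.
  have th0 : 0 <= z `^ (m + 2) / M z by rewrite divr_ge0 ?powR_ge0// ltW.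
  rewrite [X in `|X|](_ : _ = (z `^ (m + 2) / M z - 1) * H z); last by ring.
  by rewrite normrM ler_piMl// ler0_norm; lra.
have zLE : zL z = (Num.max y q)^-1.
  have -> : zL z = z / (z * Num.max y q).
    congr (_ / _); rewrite /den maxr_pMr ?ltW//; congr (Num.max _ _).
      by rewrite /z; field; rewrite lt0r_neq0.
    by rewrite mulrC.
  by rewrite invfM mulrA divff ?mul1r// lt0r_neq0.
have mx1 : 0 < Num.max y q by rewrite lt_max q0 orbT.
have mx2 : 0 < Num.max (l + y) q by rewrite lt_max q0 orbT.
have inv_le x : q <= x -> 0 <= x^-1 <= L.
  move=> qx; have x0 : 0 < x by exact: lt_le_trans qx.
  by rewrite invr_ge0 (ltW x0)/= -[L]invrK lef_pV2 ?posrE.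
have S3 : `|H z - capped_interaction (Num.max (l + y) q)^-1| <= k.
  have -> : H z = capped_interaction (Num.max y q)^-1 by rewrite -zLE.
  apply/ltW/dP.
  - by apply: inv_le; rewrite le_max lexx orbT.
  - by apply: inv_le; rewrite le_max lexx orbT.
  rewrite [X in `|X|](_ : _ = (Num.max (l + y) q - Num.max y q) / (Num.max y q * Num.max (l + y) q)); last first.
    by field; rewrite !lt0r_neq0.
  rewrite normrM normfV [X in _ / X]gtr0_norm ?mulr_gt0// ltr_pdivrMr ?mulr_gt0//.
  apply: (@le_lt_trans _ _ l).
    exact/dist_max_le/ltW.
  apply: lt_le_trans ll1 _; rewrite (ler_wpM2l (ltW d0))// expr2.
  by apply: ler_pM; rewrite ?(ltW q0)// le_max lexx orbT.
have ly0 : 0 < l + y by rewrite ltr_pwDl.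
set T := (l + y)^-1 `^ m.
have T0 : 0 <= T by exact: powR_ge0.
have aTp : a `^ p <= (a + T) `^ p.
  by apply: powR_le2 => //; rewrite ?lerDl ?(ltW a0).
have S4 : `|capped_interaction (Num.max (l + y) q)^-1 - interaction T| <= e / 2 * (a + T) `^ p.
  rewrite [e / 2](_ : _ = 2 * (e / 4)); last by field.
  by apply: cap_error => //; [exact: ltW|rewrite LT].
have := ler_wpM2l (ltW e0) aTp.
have N4 (A B C D : R) : `|A + (B + (C + D))| <= `|A| + (`|B| + (`|C| + `|D|)).
  do 2 (rewrite (le_trans (ler_normD _ _))// lerD2l); exact: ler_normD.
have -> : z `^ (m + 2) * Q.[z] - interaction T =
  (z `^ (m + 2) * Q.[z] - z `^ (m + 2) * (H z / M z)) +
  ((z `^ (m + 2) * (H z / M z) - H z) +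
  ((H z - capped_interaction (Num.max (l + y) q)^-1) +
  (capped_interaction (Num.max (l + y) q)^-1 - interaction T))) by ring.
move=> aTe; apply: le_trans (N4 _ _ _ _) _.
apply: le_trans (lerD S1 (lerD S2 (lerD S3 S4))) _.
by move: k0 aTe; rewrite /k; move: (a `^ p) ((a + T) `^ p); clear; move=> *; lra.
Qed.

End Interaction.

(** * The operator on powers of a shifted square radius *)
Section Profiles.
Context {R : realType}.
Implicit Types (m A k s l : R).

Definition profile A k s : R := (A + s) `^ (- k).
Definition profile1 A k s : R := - k * (A + s) `^ (- k - 1).
Definition profile2 A k s : R := k * (k + 1) * (A + s) `^ (- k - 2).

Lemma open_shift_gt0 A : open [set s : R | 0 < A + s].
Proof.
rewrite (_ : [set s | _] = [set s | - A < s]); first exact: open_gt.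
by apply/seteqP; split=> s /=; lra.
Qed.

Lemma is_derive_shift_powR A k s : 0 < A + s ->
  is_derive s 1 (fun s => (A + s) `^ k) (k * (A + s) `^ (k - 1)).
Proof.
move=> As0; have dA : is_derive s 1 (fun s : R => A + s) 1.
  by apply: is_derive_eq; rewrite add0r mulr1.
have := is_derive_comp_line _ _ _ _ _ _ dA (is_derive1_powR k As0).
by rewrite mulr1.
Qed.

Lemma is_derive_profile A k s : 0 < A + s ->
  is_derive s 1 (profile A k) (profile1 A k s).
Proof. exact: is_derive_shift_powR. Qed.

Lemma is_derive_profile1 A k s : 0 < A + s ->
  is_derive s 1 (profile1 A k) (profile2 A k s).
Proof.
move=> /(is_derive_shift_powR A (- k - 1) s)/(is_deriveZ (- k)).
rewrite /profile2 /GRing.scale/= mulrA.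
have -> : - k * (- k - 1) = k * (k + 1) by ring.
by have -> : - k - 1 - 1 = - k - 2 by ring.
Qed.

Lemma smooth_fun1_profile J A k : (forall s, J s -> 0 < A + s) -> smooth_fun1 J (profile A k).
Proof.
move=> JA; apply: (smooth_fun_comp _ J [set x : R | 0 < x] (fun x : R => x `^ (- k)) (fun s : R => A + s)) => //.
  exact: smooth1_powR.
by apply: (smooth_fun_add _ _ (fun=> A) id); [exact: smooth_fun_cst|exact: smooth_fun1_id].
Qed.

(** [- Laplacian / (n (n - 2))] for [n = 2 m + 2], applied to a function of the squared
    radius [s] with first and second derivatives [h1] and [h2] at [s]. *)
Definition radialN m s h1 h2 : R :=
  - (4 * s * h2 + (4 * m + 4) * h1) / (4 * m * (m + 1)).

(** The second coefficient vanishes for [k = m]: with [A = l ^ 2] this says that the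
    bubble is an exact solution. *)
Lemma radialN_profile m A k s : 0 < m -> 0 < A + s ->
  radialN m s (profile1 A k s) (profile2 A k s) =
  (k * (k + 1) * A * (A + s) `^ (- k - 2) -
   k * (k - m) * (A + s) `^ (- k - 1)) / (m * (m + 1)).
Proof.
move=> m0 As0; rewrite /radialN /profile1 /profile2.
have -> : - k - 1 = (- k - 2) + 1 by ring.
rewrite (@powRD _ (A + s) (- k - 2) 1); last by rewrite lt0r_neq0// implybT.
rewrite powRr1; last exact: ltW.
set X := _ `^ _; field.
by rewrite !lt0r_neq0// addr_gt0.
Qed.

Lemma powR_div k x y : 0 < x -> 0 < y -> x `^ k * y `^ (- k) = (x / y) `^ k.
Proof.
by move=> x0 y0; rewrite powRM ?invr_ge0 ?ltW// -(powR_inv1 (ltW y0)) -powRrM mulN1r.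
Qed.

Definition profile_bound k s0 : R :=
  s0 `^ (- k) + k * s0 `^ (- k - 1) + k * (k + 1) * s0 `^ (- k - 2).

Lemma profile_le A k s s0 : 0 <= A -> 0 < k -> 0 < s0 -> s0 <= s ->
  [/\ `|profile A k s| <= profile_bound k s0,
      `|profile1 A k s| <= profile_bound k s0 &
      `|profile2 A k s| <= profile_bound k s0].
Proof.
move=> A0 k0 s00 ss0.
have As : s0 <= A + s by rewrite ler_wpDl.
have As0 : 0 < A + s by exact: lt_le_trans As.
have le j : 0 < j -> (A + s) `^ (- j) <= s0 `^ (- j).
  by move=> j0; rewrite !powRN lef_pV2 ?posrE ?powR_gt0//; apply: powR_le2 => //; exact: ltW.
have H0 := le k k0; have H1 := le (k + 1) (ltr_pwDl k0 ler01).
have H2 := le (k + 2) (ltr_pwDl k0 (ltW (ltr0Sn _ 1))).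
rewrite (opprD k 1) in H1; rewrite (opprD k 2) in H2.
have P0 := powR_ge0 (A + s) (- k); have P1 := powR_ge0 (A + s) (- k - 1).
have P2 := powR_ge0 (A + s) (- k - 2).
rewrite /profile /profile1 /profile2 /profile_bound.
have kk : 0 < k * (k + 1) by rewrite mulr_gt0// addr_gt0.
have Q1 := ler_wpM2l (ltW k0) H1; have Q2 := ler_wpM2l (ltW kk) H2.
have R1 := mulr_ge0 (ltW k0) P1; have R2 := mulr_ge0 (ltW kk) P2.
rewrite mulNr normrN !ger0_norm//.
move: P0 R1 R2 H0 Q1 Q2.
move: ((A + s) `^ (- k)) (k * (A + s) `^ _) (k * (k + 1) * (A + s) `^ _).
move: (s0 `^ (- k)) (k * s0 `^ _) (k * (k + 1) * s0 `^ _).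
by clear; move=> *; split; lra.
Qed.

Lemma profile_bound_ge0 k s0 : 0 < k -> 0 <= profile_bound k s0.
Proof.
move=> k0; rewrite /profile_bound; have k1 : 0 <= k + 1 by rewrite addr_ge0 ?ltW.
have k0' := ltW k0; have P := powR_ge0 s0.
by rewrite addr_ge0 ?addr_ge0// !mulr_ge0.
Qed.

(** Back substitution from the top degree: [c_d = 0] and
    [al_j c_j = q_j + be_(j+1) c_(j+1)].  Since [be_0 = 0], no power below the range of the
    right-hand side is left over. *)
Lemma triangular_system (al be : nat -> R) (q : nat -> R) d :
  (forall j, al j != 0) -> be 0%N = 0 -> exists c : nat -> R, forall z,
  \sum_(j < d) c j * (al j * z ^+ j.+1 - be j * z ^+ j) =
  \sum_(j < d) q j * z ^+ j.+1.
Proof.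
move=> al0 be0.
(* The unknowns are indexed downwards from d: e i stands for c_(d - i). *)
pose e := fix e i := if i is i'.+1 then
  (q (d - i)%N + be (d - i').-1.+1 * e i') / al (d - i)%N else 0.
have eS i : (i < d)%N -> al (d - i.+1)%N * e i.+1 =
    q (d - i.+1)%N + be (d - i)%N * e i.
  move=> id; rewrite mulrC divfK//; congr (_ + be _ * _).
  by rewrite prednK// subn_gt0.
exists (fun j => e (d - j)%N) => z.
suff H (k : nat) : (k <= d)%N ->
    \sum_(j < k) e (d - j)%N * (al j * z ^+ j.+1 - be j * z ^+ j) =
    \sum_(j < k) q j * z ^+ j.+1 + be k * e (d - k)%N * z ^+ k.
  by rewrite H// subnn mulr0 mul0r addr0.
elim: k => [|k IH] kd; first by rewrite !big_ord0 be0 !mul0r addr0.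
rewrite !big_ord_recr/= IH 1?ltnW//.
have kk : (d - k.+1 < d)%N by rewrite ltn_subrL (leq_ltn_trans _ kd).
have := eS _ kk; rewrite subnSK// (subKn (ltnW kd)) (subKn kd) => E.
rewrite -!addrA; congr (_ + _).
transitivity (al k * e (d - k)%N * z ^+ k.+1); first by ring.
by rewrite E; ring.
Qed.

End Profiles.

(** * The corrected bubble *)
Section Ansatz.
Context {R : realType}.
Variables (m : R) (c : nat -> R) (d : nat).
Implicit Types (l s : R).

Definition jet (J : set R) (h h1 h2 : R -> R) :=
  [/\ smooth1 J h, forall s, J s -> is_derive s 1 h (h1 s) &
      forall s, J s -> is_derive s 1 h1 (h2 s)].

(** The bubble [l ^ m (l ^ 2 + s) ^ (- m)] plus the corrections
    [c_j l (l / (l + s)) ^ (m + j)].  The family [P] stands for the profiles or for their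
    derivatives, which keeps the three functions and their bounds uniform. *)
Definition ansatz l (P : R -> R -> R) : R :=
  l `^ m * P (l ^+ 2) m +
  \sum_(j < d) c j * l `^ (m + j%:R + 1) * P l (m + j%:R).

Lemma is_derive_ansatz l s (P P' : R -> R -> R -> R) :
  (forall A k, 0 < A + s -> is_derive s 1 (P A k) (P' A k s)) ->
  0 < l ^+ 2 + s -> 0 < l + s ->
  is_derive s 1 (fun s => ansatz l (fun A k => P A k s))
    (ansatz l (fun A k => P' A k s)).
Proof.
move=> PP l1 l2.
apply: is_deriveD; first exact: is_deriveZ (PP _ _ l1).
have H (j : 'I_d) : is_derive s 1 (c j * l `^ (m + j%:R + 1) \*: P l (m + j%:R))
    (c j * l `^ (m + j%:R + 1) * P' l (m + j%:R) s).
  exact: is_deriveZ (PP _ _ l2).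
have := is_derive_sum H; congr (is_derive _ _ _ _).
by apply/funext => t; rewrite fct_sumE.
Qed.

Definition ansatz0 l s := ansatz l (fun A k => profile A k s).
Definition ansatz1 l s := ansatz l (fun A k => profile1 A k s).
Definition ansatz2 l s := ansatz l (fun A k => profile2 A k s).

Let dom l := [set s : R | 0 < l ^+ 2 + s].

Lemma jet_ansatz l : 0 < l < 1 -> jet (dom l) (ansatz0 l) (ansatz1 l) (ansatz2 l).
Proof.
move=> /andP[l0 l1].
have ls s : dom l s -> 0 < l + s.
  move=> ls; apply: lt_le_trans ls _; rewrite lerD2r expr2.
  by rewrite ler_piMr// ltW.
split.
- apply: smooth_fun1_smooth1.
    exact: open_shift_gt0.
  apply: (smooth_fun_add _ _ (fun s => l `^ m * profile (l ^+ 2) m s)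
    (fun s => \sum_(j < d) c j * l `^ (m + j%:R + 1) * profile l (m + j%:R) s)).
    by apply: (smooth_fun_mul _ _ (fun=> l `^ m)); [exact: smooth_fun_cst|exact: smooth_fun1_profile].
  apply: smooth_fun_sum => j.
  by apply: (smooth_fun_mul _ _ (fun=> c j * l `^ (m + j%:R + 1))); [exact: smooth_fun_cst|exact: smooth_fun1_profile].
- move=> s ds; apply: is_derive_ansatz => //; last exact: ls.
  by move=> A k; exact: is_derive_profile.
- move=> s ds; apply: (is_derive_ansatz _ _ profile1 profile2) => //; last exact: ls.
  by move=> A k; exact: is_derive_profile1.
Qed.

Let z l s := l / (l + s).
Let w l s := (l / (l ^+ 2 + s)) `^ m.

Lemma bubbleE l s : 0 < l -> 0 <= s -> l `^ m * profile (l ^+ 2) m s = w l s.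
Proof.
by move=> l0 s0; rewrite /profile powR_div// ltr_pwDl// exprn_gt0.
Qed.

(** The correction is relatively small because it carries the factor [l] and
    [l / (l + s) <= l / (l ^ 2 + s)], with [l / (l + s) <= 1]. *)
Lemma correction_le l s : 0 < m -> 0 < l < 1 -> 0 <= s ->
  `|ansatz0 l s - w l s| <= (\sum_(j < d) `|c j|) * l * w l s.
Proof.
move=> m0 /andP[l0 l1] s0; rewrite /ansatz0 /ansatz bubbleE// addrC addKr.
have ls : 0 < l + s by rewrite ltr_pwDl.
have l2s : 0 < l ^+ 2 + s by rewrite ltr_pwDl// exprn_gt0.
rewrite (le_trans (ler_norm_sum _ _ _))// !mulr_suml.
apply: ler_sum => j _; rewrite -!mulrA normrM ler_wpM2l//.
have z0 : 0 < z l s by rewrite divr_gt0.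
rewrite /profile (@powRD _ l _ 1); last by rewrite lt0r_neq0// implybT.
rewrite (powRr1 (ltW l0)) mulrAC powR_div// -/(z l s) ger0_norm; last first.
  by rewrite mulr_ge0 ?powR_ge0// ltW.
rewrite mulrC ler_wpM2l ?(ltW l0)//.
apply: (@le_trans _ _ (z l s `^ m)).
  apply: ger_powR; last by rewrite lerDl.
  by rewrite z0/= ler_pdivrMr// mul1r lerDl.
apply: powR_le2 => //; first exact: ltW.
rewrite ler_wpM2l ?(ltW l0)// lef_pV2 ?posrE// lerD2r expr2.
by rewrite ler_piMr// ltW.
Qed.

(** Away from the centre everything is of order [l ^ m], uniformly in [l < 1]. *)
Lemma ansatz_le l s s0 (P : R -> R -> R) : 0 < m -> 0 < l < 1 -> 0 < s0 -> s0 <= s ->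
  (forall A k, 0 <= A -> 0 < k -> `|P A k| <= profile_bound k s0) ->
  `|ansatz l P| <= l `^ m * (profile_bound m s0 +
     \sum_(j < d) `|c j| * profile_bound (m + j%:R) s0).
Proof.
move=> m0 /andP[l0 l1] s00 ss0 PB; rewrite mulrDr (le_trans (ler_normD _ _))//.
apply: lerD.
  rewrite normrM ger0_norm ?powR_ge0// ler_wpM2l ?powR_ge0//.
  by apply: PB => //; exact: sqr_ge0.
rewrite (le_trans (ler_norm_sum _ _ _))// mulr_sumr; apply: ler_sum => j _.
have mj : 0 < m + j%:R by rewrite ltr_pwDl.
rewrite !normrM mulrCA -mulrA ler_wpM2l// ger0_norm ?powR_ge0//.
apply: ler_pM; rewrite ?powR_ge0//; last by apply: PB => //; exact: ltW.
by apply: ger_powR; rewrite ?l0 ?(ltW l1)// -addrA lerDl addr_ge0.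
Qed.

(** The assumption on [c] is the triangular system for [z Q(z)]: multiplied by
    [z ^ (m + 1)], it expresses [z ^ (m + 2) Q(z)] as the image of the correction. *)
Lemma radialN_ansatz l s (Q : {poly R}) : 0 < m -> 0 < l -> 0 <= s ->
  (forall x, \sum_(j < d) c j * ((m + j%:R) * (m + j%:R + 1) / (m * (m + 1)) * x ^+ j.+1
       - (m + j%:R) * j%:R / (m * (m + 1)) * x ^+ j) = x * Q.[x]) ->
  radialN m s (ansatz1 l s) (ansatz2 l s) =
  (l / (l ^+ 2 + s)) `^ (m + 2) + z l s `^ (m + 2) * Q.[z l s].
Proof.
move=> m0 l0 s0 cQ.
have ls : 0 < l + s by rewrite ltr_pwDl.
have l2s : 0 < l ^+ 2 + s by rewrite ltr_pwDl// exprn_gt0.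
have z0 : 0 < z l s by rewrite divr_gt0.
have -> : radialN m s (ansatz1 l s) (ansatz2 l s) =
    ansatz l (fun A k => radialN m s (profile1 A k s) (profile2 A k s)).
  rewrite /ansatz1 /ansatz2 /ansatz /radialN.
  set x := l `^ m; set N := 4 * m * (m + 1).
  rewrite (_ : \sum_(j < d) _ * (- _ / N) =
    - (4 * s * (\sum_(j < d) c j * l `^ (m + j%:R + 1) * profile2 l (m + j%:R) s)
     + (4 * m + 4) * \sum_(j < d) c j * l `^ (m + j%:R + 1) * profile1 l (m + j%:R) s) / N).
    by ring.
  rewrite !mulr_sumr -big_split/= -sumrN mulr_suml; apply: eq_bigr => j _.
  by ring.
rewrite /ansatz radialN_profile//; congr (_ + _).
  rewrite subrr mulr0 mul0r subr0 -powR_div// (opprD m 2).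
  rewrite (@powRD _ l m 2); last by rewrite lt0r_neq0// implybT.
  rewrite (powR_mulrn 2 (ltW l0)); field.
  by rewrite !lt0r_neq0// addr_gt0.
have zE : z l s `^ (m + 2) = z l s `^ (m + 1) * z l s.
  have -> : m + 2 = (m + 1) + 1 by ring.
  by rewrite powRD ?powRr1 ?(ltW z0)// lt0r_neq0// implybT.
rewrite zE -mulrA -cQ mulr_sumr; apply: eq_bigr => j _.
rewrite radialN_profile//.
have E (i : nat) : l `^ (m + j%:R + i%:R) * (l + s) `^ (- (m + j%:R) - i%:R) = z l s `^ (m + 1) * (z l s) `^ (j%:R + i%:R - 1).
  rewrite -opprD powR_div// -powRD; last by rewrite lt0r_neq0// implybT.
  by congr (_ `^ _); ring.
have E1 := E 1%N; have E2 := E 2%N.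
rewrite addrK (powR_mulrn _ (ltW z0)) in E1.
rewrite (_ : j%:R + 2 - 1 = j.+1%:R) ?(powR_mulrn _ (ltW z0)) in E2; last by rewrite -natr1; ring.
rewrite (_ : m + j%:R + 2 = m + j%:R + 1 + 1) in E2; last by ring.
rewrite (@powRD _ l _ 1) in E2; last by rewrite lt0r_neq0// implybT.
rewrite (powRr1 (ltW l0)) in E2.
set k := m + j%:R in E1 E2 *.
have -> : m + j%:R - m = j%:R by ring.
transitivity (c j / (m * (m + 1)) * (k * (k + 1) * (l `^ (k + 1) * l * (l + s) `^ (- k - 2))
   - k * j%:R * (l `^ (k + 1) * (l + s) `^ (- k - 1)))); first by ring.
by rewrite E1 E2; ring.
Qed.

End Ansatz.

(** * Cutting off *)
Section CutoffJet.
Context {R : realType}.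
Implicit Types (J : set R) (s : R).

Lemma smooth1_subset J J' (h : R -> R) : J' `<=` J -> smooth1 J h -> smooth1 J' h.
Proof. by move=> JJ [H [H0 HS]]; exists H; split=> // k x /JJ; exact: HS. Qed.

Lemma jet_subset J J' (h h1 h2 : R -> R) : J' `<=` J -> jet J h h1 h2 -> jet J' h h1 h2.
Proof.
move=> JJ [hs d1 d2]; split; first exact: smooth1_subset hs.
- by move=> s /JJ; exact: d1.
- by move=> s /JJ; exact: d2.
Qed.

Lemma jetM J (f f1 f2 g g1 g2 : R -> R) : open J -> jet J f f1 f2 -> jet J g g1 g2 ->
  jet J (fun s => f s * g s) (fun s => f s * g1 s + g s * f1 s)
    (fun s => f s * g2 s + 2 * (f1 s * g1 s) + g s * f2 s).
Proof.
move=> oJ [fs fd fd1] [gs gd gd1]; split.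
- apply: smooth_fun1_smooth1 => //.
  by apply: smooth_fun_mul; exact: smooth1_smooth_fun1.
- by move=> s Js; exact: is_deriveM (fd s Js) (gd s Js).
- move=> s Js.
  have D1 := is_deriveM (fd s Js) (gd1 s Js).
  have D2 := is_deriveM (gd s Js) (fd1 s Js).
  apply: is_derive_eq (is_deriveD D1 D2) _.
  by rewrite /GRing.scale/=; ring.
Qed.

Lemma is_derive_near_cst (f : R -> R) (s df k : R) :
  is_derive s 1 f df -> (\near s, f s = k) -> df = 0.
Proof.
move=> [_ <-] fk; rewrite (@near_eq_derive _ _ _ f (cst k))//.
exact: derive_cst.
Qed.

(** The bound [B] exists because the derivatives are continuous and vanish outside
    a compact interval. *)
Lemma cutoff_jet (s0 : R) : 0 < s0 -> exists c c1 c2 : R -> R, exists2 B : R, 0 <= B &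
  [/\ jet setT c c1 c2, forall s, 0 <= c s <= 1,
      forall s, s < s0 -> [/\ c s = 1, c1 s = 0 & c2 s = 0],
      forall s, 2 * s0 < s -> [/\ c s = 0, c1 s = 0 & c2 s = 0] &
      forall s, `|c1 s| <= B /\ `|c2 s| <= B].
Proof.
move=> s00; have [k [ks k01 k1 k0]] := @cutoff_exists R.
have [H [H0 HS]] : smooth1 setT (fun s => k (s / s0 - 1)).
  apply: smooth_fun1_smooth1; first exact: openT.
  apply: (smooth_fun_comp _ _ setT k (fun s => s / s0 - 1)) => //.
  apply: (smooth_fun_add _ _ (fun s => s / s0) (fun=> -1)); last exact: smooth_fun_cst.
  by apply: (smooth_fun_mul _ _ id (fun=> s0^-1)); [exact: smooth_fun1_id|exact: smooth_fun_cst].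
have {}H0 s : H 0%N s = k (s / s0 - 1) by rewrite H0.
have cl s : s < s0 -> [/\ H 0%N s = 1, H 1%N s = 0 & H 2%N s = 0].
  have c0 t : t < s0 -> H 0%N t = 1.
    by move=> ts; rewrite H0 k1// subr_le0 ler_pdivrMr// mul1r ltW.
  have c1 t : t < s0 -> H 1%N t = 0.
    move=> ts; apply: (is_derive_near_cst _ _ _ 1 (HS 0%N t I)).
    by near=> u; apply: c0; near: u; exact: lt_nbhsl.
  move=> ss; split; [exact: c0|exact: c1|].
  apply: (is_derive_near_cst _ _ _ 0 (HS 1%N s I)).
  by near=> u; apply: c1; near: u; exact: lt_nbhsl.
have cr s : 2 * s0 < s -> [/\ H 0%N s = 0, H 1%N s = 0 & H 2%N s = 0].
  have c0 t : 2 * s0 < t -> H 0%N t = 0.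
    by move=> ts; rewrite H0 k0// lerBrDr -[1 + 1]/(2 : R) ler_pdivlMr// ltW.
  have c1 t : 2 * s0 < t -> H 1%N t = 0.
    move=> ts; apply: (is_derive_near_cst _ _ _ 0 (HS 0%N t I)).
    by near=> u; apply: c0; near: u; exact: lt_nbhsr.
  move=> ss; split; [exact: c0|exact: c1|].
  apply: (is_derive_near_cst _ _ _ 0 (HS 1%N s I)).
  by near=> u; apply: c1; near: u; exact: lt_nbhsr.
have bnd i : (0 < i < 3)%N -> exists2 B, 0 <= B & forall s, `|H i s| <= B.
  move=> i13; have Hc s : {for s, continuous (H i)}.
    exact: is_derive1_continuous (HS i s I).
  have [||t _ tB] := @EVT_max R (fun s => `|H i s|) s0 (2 * s0).
  - by lra.
  - apply: continuous_in_subspaceT => s _.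
    by apply: continuous_comp; [exact: Hc|exact: norm_continuous].
  exists `|H i t| => // s.
  have [/cl[_ E1 E2]|s1] := ltP s s0.
    by case: i i13 {Hc tB} => [|[|[|i]]]//; rewrite ?E1 ?E2 normr0.
  have [/cr[_ E1 E2]|s2] := ltP (2 * s0) s.
    by case: i i13 {Hc tB} => [|[|[|i]]]//; rewrite ?E1 ?E2 normr0.
  by apply: tB; rewrite in_itv/= s1.
have [B1 B10 HB1] := bnd 1%N isT; have [B2 B20 HB2] := bnd 2%N isT.
exists (H 0%N), (H 1%N), (H 2%N), (B1 + B2); first exact: addr_ge0.
split=> //.
- split; [|by move=> s; exact: HS|by move=> s; exact: HS].
  by exists H; split.
- by move=> s; rewrite H0.
- by move=> s; rewrite (le_trans (HB1 s)) ?(le_trans (HB2 s))// (lerDl, lerDr).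
Unshelve. all: by end_near. Qed.

End CutoffJet.

(** * The radial bump *)
Section LocalBump.
Context {R : realType}.
Implicit Types (m a e s : R).

(** All the smallness conditions on [l] are of one of these forms. *)
Lemma choose_scale (m C d1 W l1 : R) : 0 < m -> 0 <= C -> 0 < d1 -> 0 <= W -> 0 < l1 ->
  exists l : R, [/\ 0 < l < 1, l < l1, C * l <= d1 & l `^ m * W <= 1].
Proof.
move=> m0 C0 d10 W0 l10.
pose x1 := d1 / (C + 1); pose x2 := (W + 1)^-1 `^ m^-1.
have C1 : 0 < C + 1 by rewrite ltr_wpDl.
have W1 : 0 < W + 1 by rewrite ltr_wpDl.
have x10 : 0 < x1 by rewrite divr_gt0.
have x20 : 0 < x2 by rewrite powR_gt0// invr_gt0.
exists (Num.min (Num.min (1 / 2) (l1 / 2)) (Num.min x1 x2)).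
set l := Num.min _ _.
have [lh ll lx1 lx2] : [/\ l <= 1 / 2, l <= l1 / 2, l <= x1 & l <= x2].
  by rewrite /l; split; rewrite !ge_min lexx ?orbT.
have l0 : 0 < l.
  by rewrite /l !lt_min x10 x20 !divr_gt0.
split.
- by rewrite l0 (le_lt_trans lh)// ltr_pdivrMr// mul1r ltr1n.
- by rewrite (le_lt_trans ll)// ltr_pdivrMr// ltr_pMr// ltr1n.
- apply: (@le_trans _ _ (C * x1)); first exact: ler_wpM2l.
  rewrite /x1 mulrCA ler_piMr ?(ltW d10)// ler_pdivrMr// mul1r lerDl//.
- have lm : l `^ m <= (W + 1)^-1.
    by apply: powR_le_root => //; [rewrite invr_ge0 ltW|exact: ltW].
  apply: (@le_trans _ _ ((W + 1)^-1 * W)); first exact: ler_wpM2r.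
  by rewrite mulrC ler_pdivrMr// mul1r lerDl.
Qed.

(** Where the cutoff is 1: [w ^ p + V] is the image of the corrected bubble [f],
    and both [V] and [f] are as good as the interaction term and [w]. *)
Lemma core_estimate (a p e d1 w f V : R) : 0 < a -> 0 <= w -> 0 < e <= 1 / 2 ->
  0 < d1 < 1 ->
  (forall x y, 0 <= y -> `|x - y| <= d1 * y -> `|x `^ p - y `^ p| <= e * y `^ p) ->
  `|V - interaction a p w| <= e * (a + w) `^ p -> `|f - w| <= d1 * w ->
  `|w `^ p + V - ((a + f) `^ p - a `^ p)| <= 4 * e * (a + f) `^ p.
Proof.
move=> a0 w0 /andP[e0 e2] /andP[d10 d11] dP HV fw.
have aw0 : 0 <= a + w by rewrite addr_ge0 ?(ltW a0).
have H : `|(a + f) `^ p - (a + w) `^ p| <= e * (a + w) `^ p.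
  apply: dP => //; rewrite opprD addrACA subrr add0r (le_trans fw)//.
  by rewrite ler_wpM2l ?(ltW d10)// lerDr ltW.
have := powR_ge0 (a + w) p.
move: HV H; rewrite /interaction.
move: ((a + w) `^ p) ((a + f) `^ p) (a `^ p) (w `^ p) => A F A0 Wp.
rewrite !ler_norml => /andP[V1 V2] /andP[H1 H2] A00.
have eA : e * A <= 1 / 2 * A by exact: ler_wpM2r.
have eF : e * A <= 2 * (e * F).
  have : A <= 2 * F by clear -H1 H2 eA; lra.
  by move=> /(ler_wpM2l (ltW e0)); rewrite mulrCA.
move: V1 V2 H1 H2 eF; rewrite -mulrA; move: (e * A) (e * F); clear.
by move=> *; apply/andP; split; lra.
Qed.

Lemma radialN_le m s h1 h2 S X1 X2 : 0 < m -> 0 <= s -> s <= S ->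
  `|h1| <= X1 -> `|h2| <= X2 ->
  `|radialN m s h1 h2| <= (4 * S * X2 + (4 * m + 4) * X1) / (4 * m * (m + 1)).
Proof.
move=> m0 s0 sS hX1 hX2; have m1 : 0 < m + 1 by rewrite addr_gt0.
have mm : 0 < 4 * m * (m + 1) by rewrite !mulr_gt0.
rewrite /radialN normrM normfV normrN [`|4 * m * _|]gtr0_norm//.
rewrite ler_wpM2r ?invr_ge0 ?(ltW mm)// (le_trans (ler_normD _ _))// !normrM.
rewrite [`|s|]ger0_norm// [`|4|]ger0_norm// [`|4 * m + 4|]ger0_norm; last first.
  by rewrite addr_ge0 ?mulr_ge0// ltW.
apply: lerD; last by rewrite ler_wpM2l// addr_ge0 ?mulr_ge0// ltW.
by apply: ler_pM => //; rewrite ?mulr_ge0// ler_wpM2l.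
Qed.

(** Where the cutoff acts: [f] and its image [V] are so small that each
    term is within the tolerance [a ^ p]. *)
Lemma tail_estimate (a p e d1 f V : R) : 0 < a -> 0 < e <= 1 / 2 ->
  (forall x y, 0 <= y -> `|x - y| <= d1 * y -> `|x `^ p - y `^ p| <= e * y `^ p) ->
  `|V| <= e * a `^ p -> 0 <= f <= d1 * a ->
  `|V - ((a + f) `^ p - a `^ p)| <= 4 * e * (a + f) `^ p.
Proof.
move=> a0 /andP[e0 e2] dP HV /andP[f0 fd].
have H : `|(a + f) `^ p - a `^ p| <= e * a `^ p.
  by apply: dP; rewrite ?(ltW a0)// addrAC subrr add0r ger0_norm.
have := powR_ge0 a p.
move: HV H.
move: ((a + f) `^ p) (a `^ p) => F A.
rewrite !ler_norml => /andP[V1 V2] /andP[H1 H2] A00.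
have eA : e * A <= 1 / 2 * A by exact: ler_wpM2r.
have eF : e * A <= 2 * (e * F).
  have : A <= 2 * F by clear -H1 H2 eA; lra.
  by move=> /(ler_wpM2l (ltW e0)); rewrite mulrCA.
move: V1 V2 H1 H2 eF; rewrite -mulrA; move: (e * A) (e * F); clear.
by move=> *; apply/andP; split; lra.
Qed.

(** The bound of [radialN_le] for the product of the cutoff and the ansatz, when
    [l ^ m D] bounds the latter and [B] the derivatives of the former; the factor
    [l ^ m] is left out. *)
Definition tail_constant m r D B : R :=
  (4 * r * (D + 2 * (B * D) + D * B) + (4 * m + 4) * (D + D * B)) / (4 * m * (m + 1)).

Lemma tail_constant_ge0 m r D B : 0 <= m -> 0 <= r -> 0 <= D -> 0 <= B ->
  0 <= tail_constant m r D B.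
Proof.
move=> m0 r0 D0 B0; rewrite /tail_constant.
by do ![exact: ler01 | exact: ler0n | assumption | apply: divr_ge0 | apply: mulr_ge0 | apply: addr_ge0].
Qed.

(** For each fixed [a], [e], [r] and [M] the bump exists once [l] is small enough.  The
    squared radius [s] is below [r / 3] in the core, where the cutoff is 1, and above
    [2 r / 3] where it is 0. *)
Lemma local_bump m a e M r : 0 < m -> 0 < a -> 0 < e -> 0 < r ->
  let p := (m + 2) / m in
  exists J g g1 g2, [/\ open J, (forall s, 0 <= s -> J s), jet J g g1 g2,
    (forall s, r <= s -> [/\ g s = 0, g1 s = 0 & g2 s = 0]) &
    M <= g 0 /\ forall s, 0 <= s -> 0 <= g s /\
      `|radialN m s (g1 s) (g2 s) - ((a + g s) `^ p - a `^ p)| <= e * (a + g s) `^ p].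
Proof.
move=> m0 a0 eps0 r0 p.
have p0 : 0 < p by rewrite divr_gt0// addr_gt0.
have mp : m * p = m + 2 by rewrite mulrCA divff ?mulr1// lt0r_neq0.
have ap0 : 0 < a `^ p by rewrite powR_gt0.
(* Both core_estimate and tail_estimate lose a factor 4. *)
pose e' := Num.min (e / 4) (1 / 2).
have e'0 : 0 < e' by rewrite lt_min !divr_gt0.
have e'2 : 0 < e' <= 1 / 2 by rewrite e'0 ge_min lexx orbT.
have e'e : 4 * e' <= e by rewrite mulrC -ler_pdivlMr// ge_min lexx.
suff: exists J g g1 g2, [/\ open J, (forall s, 0 <= s -> J s), jet J g g1 g2,
    (forall s, r <= s -> [/\ g s = 0, g1 s = 0 & g2 s = 0]) &
    M <= g 0 /\ forall s, 0 <= s -> 0 <= g s /\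
      `|radialN m s (g1 s) (g2 s) - ((a + g s) `^ p - a `^ p)| <= 4 * e' * (a + g s) `^ p].
  move=> [J [g [g1 [g2 [oJ J0 jg gr [gM gE]]]]]].
  exists J, g, g1, g2; split => //; split=> // s s0; have [g0 gs] := gE s s0.
  by split=> //; rewrite (le_trans gs)// ler_wpM2r// powR_ge0.
have [Q [l1 l10 HQ]] := interaction_approx a m p a0 m0 p0 e' e'0.
have mm1 : 0 < m * (m + 1) by rewrite mulr_gt0// addr_gt0.
pose al j := (m + j%:R) * (m + j%:R + 1) / (m * (m + 1)).
pose be j := (m + j%:R) * j%:R / (m * (m + 1)).
have al0 j : al j != 0.
  rewrite lt0r_neq0// divr_gt0// mulr_gt0//; first by rewrite ltr_pwDl.
  by rewrite ltr_wpDl// addr_ge0// ltW.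
have be0 : be 0%N = 0 by rewrite /be mulr0 mul0r.
have [c Hc] := triangular_system al be (fun j => Q`_j) (size Q) al0 be0.
have {}Hc x : \sum_(j < size Q) c j * ((m + j%:R) * (m + j%:R + 1) / (m * (m + 1)) * x ^+ j.+1
       - (m + j%:R) * j%:R / (m * (m + 1)) * x ^+ j) = x * Q.[x].
  rewrite Hc horner_coef mulr_sumr; apply: eq_bigr => j _.
  by rewrite exprS mulrCA.
pose s0 := r / 3; have s00 : 0 < s0 by rewrite divr_gt0.
have rs0 : r = 3 * s0 by rewrite /s0; field.
have [k [k1 [k2 [B B0 [jk k01 kl kr kB]]]]] := cutoff_jet s0 s00.
have [d1 [d101 dP]] := powR_close p p0 e' e'0.
have /andP[d10 d11] := d101.
pose C := \sum_(j < size Q) `|c j|; have C0 : 0 <= C by exact: sumr_ge0.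
pose D := profile_bound m s0 + \sum_(j < size Q) `|c j| * profile_bound (m + j%:R) s0.
have D0 : 0 <= D.
  rewrite addr_ge0 ?profile_bound_ge0// sumr_ge0// => j _.
  by rewrite mulr_ge0// profile_bound_ge0// ltr_pwDl.
pose E := tail_constant m r D B.
have E0 : 0 <= E by exact: (tail_constant_ge0 m r D B (ltW m0) (ltW r0) D0 B0).
(* One condition l ^ m W <= 1 covers three: a large value at the centre, and a small bump with a small image in the tail. *)
pose W := 2 * `|M| + D / (d1 * a) + E / (e' * a `^ p).
have W1 : 0 <= 2 * `|M| by rewrite mulr_ge0.
have W2 : 0 <= D / (d1 * a) by rewrite divr_ge0// mulr_ge0// ltW.
have W3 : 0 <= E / (e' * a `^ p) by rewrite divr_ge0// mulr_ge0// ltW.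
have W0 : 0 <= W by rewrite !addr_ge0.
have d12 : 0 < d1 / 2 by rewrite divr_gt0.
have [l [l01 ll1 Cl lW]] := choose_scale m C (d1 / 2) W l1 m0 C0 d12 W0 l10.
have /andP[l0 l_1] := l01.
have lm0 : 0 < l `^ m by rewrite powR_gt0.
have lWi x : 0 <= x -> x <= W -> l `^ m * x <= 1.
  by move=> x0 xW; apply: le_trans lW; rewrite ler_wpM2l// ltW.
have lM : l `^ m * (2 * `|M|) <= 1.
  by apply: lWi => //; rewrite /W -addrA lerDl addr_ge0.
have lD : l `^ m * D <= d1 * a.
  have : l `^ m * (D / (d1 * a)) <= 1 by apply: lWi => //; rewrite /W addrAC lerDr addr_ge0.
  by rewrite mulrA ler_pdivrMr ?mul1r// mulr_gt0.
have lE : l `^ m * E <= e' * a `^ p.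
  have : l `^ m * (E / (e' * a `^ p)) <= 1 by apply: lWi => //; rewrite /W lerDr addr_ge0.
  by rewrite mulrA ler_pdivrMr ?mul1r// mulr_gt0.
pose J := [set s : R | 0 < l ^+ 2 + s].
have oJ : open J.
  exact: open_shift_gt0.
pose f0 := ansatz0 m c (size Q) l.
pose f1 := ansatz1 m c (size Q) l.
pose f2 := ansatz2 m c (size Q) l.
have jf : jet J f0 f1 f2 := jet_ansatz m c (size Q) l l01.
have jg := jetM J _ _ _ _ _ _ oJ (jet_subset _ J _ _ _ (@subsetT _ J) jk) jf.
have J0 s : 0 <= s -> J s by move=> s0'; rewrite /J/= ltr_pwDl// exprn_gt0.
pose w s := (l / (l ^+ 2 + s)) `^ m.
have w0 s : 0 <= w s by exact: powR_ge0.
have fw s : 0 <= s -> `|f0 s - w s| <= d1 / 2 * w s.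
  move=> s0'; apply: le_trans (correction_le m c (size Q) l s m0 l01 s0') _.
  exact: (ler_wpM2r (w0 s) Cl).
have fw2 s : 0 <= s -> w s / 2 <= f0 s.
  move=> s0'; have := fw s s0'; have : d1 / 2 * w s <= 1 / 2 * w s.
    by rewrite ler_wpM2r// ler_wpM2r ?invr_ge0// ltW.
  move: (d1 / 2 * w s) (w s) (f0 s); clear => x y t xy.
  by rewrite ler_norml => /andP[+ _]; lra.
exists J, (fun s => k s * f0 s), (fun s => k s * f1 s + f0 s * k1 s),
  (fun s => k s * f2 s + 2 * (k1 s * f1 s) + f0 s * k2 s).
have far s : 2 * s0 < s -> [/\ k s * f0 s = 0, k s * f1 s + f0 s * k1 s = 0 &
    k s * f2 s + 2 * (k1 s * f1 s) + f0 s * k2 s = 0].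
  by move=> /kr[-> -> ->]; rewrite !mul0r !mulr0 !addr0.
split=> //.
  by move=> s rs; apply: far; apply: lt_le_trans rs; rewrite rs0 ltr_pM2r// ltr_nat.
split.
  have [-> _ _] := kl 0 s00; rewrite mul1r; apply: le_trans (fw2 0 (lexx 0)).
  rewrite ler_pdivlMr// mulrC; apply: (@le_trans _ _ (2 * `|M|)).
    by rewrite ler_wpM2l// ler_norm.
  have -> : w 0 = (l `^ m)^-1.
    rewrite /w addr0 expr2 invfM mulrA divff ?lt0r_neq0// mul1r.
    by rewrite -(powR_inv1 (ltW l0)) -powRrM mulN1r powRN.
  by rewrite -[leRHS]mul1r ler_pdivlMr// mulrC.
move=> s sge0; have f00 : 0 <= f0 s by rewrite (le_trans _ (fw2 s sge0))// divr_ge0.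
have /andP[ks0 ks1] := k01 s.
split; first exact: mulr_ge0.
have [ss0|s0s] := ltP s s0.
  have [-> -> ->] := kl s ss0; rewrite !mul1r !mulr0 mul0r mulr0 !addr0.
  rewrite (radialN_ansatz m c (size Q) l s Q m0 l0 sge0 Hc).
  have -> : (l / (l ^+ 2 + s)) `^ (m + 2) = w s `^ p by rewrite /w -powRrM mp.
  apply: (core_estimate a p e' d1) => //; last first.
    apply: le_trans (fw s sge0) _; rewrite ler_wpM2r// ler_pdivrMr// ler_pMr// ler1n//.
  have := HQ l (s / l); rewrite l0 ll1 divr_ge0 ?(ltW l0)// => /(_ isT isT) /=.
  have -> : (1 + s / l)^-1 = l / (l + s).
    by field; rewrite !lt0r_neq0// ltr_pwDl.
  have -> : (l + s / l)^-1 = l / (l ^+ 2 + s).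
    by field; rewrite !lt0r_neq0// ltr_pwDl// mulr_gt0.
  by [].
have [s2|s2] := ltP (2 * s0) s.
  have [-> -> ->] := far s s2; rewrite addr0 subrr subr0 /radialN !mulr0 addr0 oppr0 mul0r normr0.
  by rewrite mulr_ge0 ?powR_ge0// mulr_ge0// ltW.
have bf0 : `|f0 s| <= l `^ m * D.
  by apply: (ansatz_le m c (size Q) l s s0) => // A h A0 h0; have [] := profile_le A h s s0 A0 h0 s00 s0s.
have bf1 : `|f1 s| <= l `^ m * D.
  by apply: (ansatz_le m c (size Q) l s s0) => // A h A0 h0; have [] := profile_le A h s s0 A0 h0 s00 s0s.
have bf2 : `|f2 s| <= l `^ m * D.
  by apply: (ansatz_le m c (size Q) l s s0) => // A h A0 h0; have [] := profile_le A h s s0 A0 h0 s00 s0s.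
have [bk1 bk2] := kB s.
have nk : `|k s| <= 1 by rewrite ger0_norm.
have lD0 : 0 <= l `^ m * D by rewrite mulr_ge0// ltW.
have kf x y X Y : `|x| <= X -> `|y| <= Y -> `|x * y| <= X * Y.
  by move=> xX yY; rewrite normrM ler_pM.
apply: (tail_estimate a p e' d1) => //; last first.
  rewrite mulr_ge0//=; apply: le_trans lD; rewrite -[leRHS]mul1r.
  by apply: ler_pM => //; apply: le_trans bf0; exact: ler_norm.
have sr : s <= r by rewrite rs0 (le_trans s2)// ler_wpM2r ?(ltW s00)// ler_nat.
have X1 : `|k s * f1 s + f0 s * k1 s| <= l `^ m * (D + D * B).
  have -> : l `^ m * (D + D * B) = 1 * (l `^ m * D) + l `^ m * D * B by ring.
  by rewrite (le_trans (ler_normD _ _))//; apply: lerD; exact: kf.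
have X2 : `|k s * f2 s + 2 * (k1 s * f1 s) + f0 s * k2 s| <= l `^ m * (D + 2 * (B * D) + D * B).
  have -> : l `^ m * (D + 2 * (B * D) + D * B) = 1 * (l `^ m * D) + 2 * (B * (l `^ m * D)) + l `^ m * D * B by ring.
  rewrite (le_trans (ler_normD _ _))//; apply: lerD; last exact: kf.
  rewrite (le_trans (ler_normD _ _))//; apply: lerD; apply: (kf) => //.
    by rewrite ger0_norm.
  exact: kf.
apply: le_trans lE; apply: le_trans (radialN_le m s _ _ r _ _ m0 sge0 sr X1 X2) _.
by rewrite /E /tail_constant le_eqVlt; apply/orP; left; apply/eqP; ring.
Qed.

End LocalBump.

(** * Laplacian and distances in the Euclidean space *)
Section Laplacian.
Context {R : realType} {n : nat}.
Implicit Types (D : set 'rV[R]_n) (f g : 'rV[R]_n -> R).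

Lemma partial_ext D i f g : open D -> (forall x, D x -> f x = g x) ->
  forall x, D x -> partial i f x = partial i g x.
Proof.
move=> oD fg x Dx; apply: near_eq_derive.
by apply: filterS (open_nbhs_nbhs (conj oD Dx)) => y; exact: fg.
Qed.

Lemma laplacian_ext D f g : open D -> (forall x, D x -> f x = g x) ->
  forall x, D x -> laplacian f x = laplacian g x.
Proof.
move=> oD fg x Dx; apply: eq_bigr => i _.
by apply: (partial_ext D) => // y Dy; exact: (partial_ext D).
Qed.

Lemma partialD D i f g : open D -> smooth_fun basis D f -> smooth_fun basis D g ->
  forall x, D x -> partial i (fun y => f y + g y) x = partial i f x + partial i g x.
Proof.
move=> oD fD gD x Dx.
have [f' _ /(_ x Dx) df] := smooth_fun_derive _ _ oD _ fD i.
have [g' _ /(_ x Dx) dg] := smooth_fun_derive _ _ oD _ gD i.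
have [_ Ef] := df; have [_ Eg] := dg.
by have [_] := is_deriveD df dg; rewrite -{}Ef -{}Eg.
Qed.

(** Additivity needs the second derivatives to exist, hence the smoothness
    class. *)
Lemma laplacianD D f g : open D -> smooth_fun basis D f -> smooth_fun basis D g ->
  forall x, D x -> laplacian (fun y => f y + g y) x = laplacian f x + laplacian g x.
Proof.
move=> oD fD gD x Dx; rewrite /laplacian -big_split/=; apply: eq_bigr => i _.
have H := partialD D i f g oD fD gD.
rewrite (partial_ext D i _ (fun y => partial i f y + partial i g y) oD)//.
by apply: (partialD D) => //; exact: (smooth_fun_partials D _ [:: i]).
Qed.

Lemma laplacian_sum D (N : nat) (F : nat -> 'rV[R]_n -> R) : open D ->
  (forall i, smooth_fun basis D (F i)) -> forall x, D x ->
  laplacian (fun y => \sum_(i < N) F i y) x = \sum_(i < N) laplacian (F i) x.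
Proof.
move=> oD FD x Dx; elim: N => [|N IH].
  rewrite big_ord0 (laplacian_ext D _ (fun=> 0) oD)//; last by move=> y _; rewrite big_ord0.
  rewrite /laplacian big1// => i _.
  have -> : partial i (fun=> 0 : R) = (fun=> 0) :> ('rV[R]_n -> R).
    by apply/funext => y; exact: derive_cst.
  exact: derive_cst.
rewrite big_ord_recr/= -IH.
rewrite (laplacian_ext D _ (fun y => \sum_(i < N) F i y + F N y) oD)//; last first.
  by move=> y _; rewrite big_ord_recr.
by apply: (laplacianD D) => //; exact: smooth_fun_sum.
Qed.

Lemma smooth_fun_laplacian D f : open D -> smooth_fun basis D f -> smooth_fun basis D (laplacian f).
Proof.
move=> oD fD; apply: smooth_fun_sum => i; exact: (smooth_fun_partials D f [:: i; i]).
Qed.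

Lemma smooth_fun_radial D J (h h1 h2 : R -> R) (y : 'rV[R]_n) :
  (forall s, 0 <= s -> J s) -> jet J h h1 h2 -> smooth_fun basis D (fun x => h (dist2 x y)).
Proof.
move=> J0 [hJ _ _]; apply: (smooth_fun_comp _ D J h (dist2 ^~ y)) => //.
  by move=> x _; apply: J0; exact: dist2_ge0.
exact: smooth_fun_dist2.
Qed.

Lemma radialN_laplacian (m : R) J (h h1 h2 : R -> R) (x y : 'rV[R]_n) :
  n%:R = 2 * m + 2 -> 0 < m ->
  (forall s, 0 <= s -> J s) -> jet J h h1 h2 ->
  - laplacian (fun x => h (dist2 x y)) x / (n%:R * (n%:R - 2)) =
  radialN m (dist2 x y) (h1 (dist2 x y)) (h2 (dist2 x y)).
Proof.
move=> nm m0 J0 [_ d1 d2].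
rewrite (laplacian_radial J h h1 h2)//; last by move=> z; apply: J0; exact: dist2_ge0.
rewrite nm /radialN; field.
by apply/and4P; split; rewrite lt0r_neq0//; clear -m0; lra.
Qed.

Lemma coord_le_dist2 (x y : 'rV[R]_n) i : (x ord0 i - y ord0 i) ^+ 2 <= dist2 x y.
Proof.
by rewrite /dist2 (bigD1 i)//= lerDl sumr_ge0// => j _; rewrite sqr_ge0.
Qed.

Lemma coord_lt_dist2 (x y : 'rV[R]_n) r i : 0 < r -> dist2 x y < r ^+ 2 ->
  `|x ord0 i - y ord0 i| < r.
Proof.
move=> r0 xy; rewrite -(ltr_pXn2r (n := 2))// ?nnegrE ?(ltW r0)//.
by rewrite real_normK ?num_real// (le_lt_trans (coord_le_dist2 x y i)).
Qed.

Lemma dist2_tri (x y z : 'rV[R]_n) : dist2 x z <= 2 * dist2 x y + 2 * dist2 y z.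
Proof.
rewrite /dist2 !mulr_sumr -big_split/=; apply: ler_sum => i _.
have -> : x ord0 i - z ord0 i = (x ord0 i - y ord0 i) + (y ord0 i - z ord0 i) by ring.
move: (_ - _) (y _ _ - _); clear => a b.
by have := sqr_ge0 (a - b); rewrite !expr2; lra.
Qed.

Lemma open_dist2_lt (y : 'rV[R]_n) r : open [set x | dist2 x y < r].
Proof.
apply: (open_comp _ (@open_lt R r)) => x _.
exact: (smooth_fun_continuous _ setT openT _ (smooth_fun_dist2 setT y) x I).
Qed.

Lemma open_dist2_gt (y : 'rV[R]_n) r : open [set x | r < dist2 x y].
Proof.
apply: (open_comp _ (@open_gt R r)) => x _.
exact: (smooth_fun_continuous _ setT openT _ (smooth_fun_dist2 setT y) x I).
Qed.

Lemma continuous_dist2_ball (f : 'rV[R]_n -> R) (y : 'rV[R]_n) e :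
  {for y, continuous f} -> 0 < e ->
  exists2 r, 0 < r & forall x, dist2 x y < r ^+ 2 -> `|f x - f y| <= e.
Proof.
move=> fy e0; have /cvgrPdist_le/(_ _ e0)/nbhs_ballP[r /= r0 rP] := fy.
exists r => // x xy; rewrite distrC; apply: rP.
split=> // i j; rewrite ord1 /ball/= distrC; exact: coord_lt_dist2.
Qed.

Lemma dist2_0 (x : 'rV[R]_n) : dist2 x 0 = enorm x ^+ 2.
Proof.
rewrite /enorm sqr_sqrtr; last by apply: sumr_ge0 => i _; exact: sqr_ge0.
by apply: eq_bigr => i _; rewrite mxE subr0.
Qed.

Lemma dist2_0_gt0 (x : 'rV[R]_n) : x != 0 -> 0 < dist2 x 0.
Proof.
move=> x0; rewrite lt_def dist2_ge0 andbT; apply: contra x0 => /eqP x0.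
apply/eqP/rowP => i; rewrite mxE; apply/eqP; rewrite -sqrf_eq0 eq_le sqr_ge0 andbT.
by rewrite -{}x0; have := coord_le_dist2 x 0 i; rewrite mxE subr0.
Qed.

End Laplacian.

(** * A bump on top of the standard bubble *)
Section OneBump.
Context {R : realType} {n : nat}.
Implicit Types (x y : 'rV[R]_n).

(** Passing from the constant [a] to a nearby value [b] of the background: all the
    quantities change by a small fraction of [(a + h) ^ p]. *)
Lemma shift_estimate (p e : R) : 0 < p -> 0 < e -> exists d e' : R,
  [/\ 0 < d, 0 < e' & forall a b h V, 0 < a -> 0 <= h -> `|b - a| <= d * a ->
    `|V - ((a + h) `^ p - a `^ p)| <= e' * (a + h) `^ p ->
    `|b `^ p + V - (b + h) `^ p| <= e * (b + h) `^ p].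
Proof.
move=> p0 e0; pose e' := Num.min (e / 6) (1 / 2).
have e'0 : 0 < e' by rewrite lt_min !divr_gt0.
have e'2 : e' <= 1 / 2 by rewrite ge_min lexx orbT.
have e'e : 6 * e' <= e by rewrite mulrC -ler_pdivlMr// ge_min lexx.
have [d [/andP[d0 d1] dP]] := powR_close p p0 e' e'0.
exists d, e'; split=> // a b h V a0 h0 ba HV.
have H1 : `|b `^ p - a `^ p| <= e' * a `^ p by apply: dP => //; exact: ltW.
have H2 : `|(b + h) `^ p - (a + h) `^ p| <= e' * (a + h) `^ p.
  apply: dP; first by rewrite addr_ge0// ltW.
  rewrite opprD addrACA subrr addr0 (le_trans ba)// ler_wpM2l ?(ltW d0)//.
  by rewrite lerDl.
have aA : a `^ p <= (a + h) `^ p.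
  by apply: (powR_le2 p a (a + h) p0 (ltW a0)); rewrite lerDl.
have B0 := powR_ge0 (b + h) p; have A0 := powR_ge0 (a + h) p.
move: H1 H2 HV aA A0 B0.
move: ((b + h) `^ p) ((a + h) `^ p) (a `^ p) (b `^ p) => B A X Y.
move=> H1 H2 HV aA A0 B0.
have eX : e' * X <= e' * A by rewrite ler_wpM2l// ltW.
have eA : e' * A <= 1 / 2 * A by exact: ler_wpM2r.
have eB : 6 * (e' * B) <= e * B by rewrite mulrA ler_wpM2r.
move: H1 H2 HV; rewrite !ler_norml => /andP[H1 H1'] /andP[H2 H2'] /andP[H3 H3'].
have AB : e' * A <= 2 * (e' * B).
  have : A <= 2 * B by clear -H2 H2' eA; lra.
  by move=> /(ler_wpM2l (ltW e'0)); rewrite mulrCA.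
move: H1 H1' H2 H2' H3 H3' eX eB AB.
move: (e' * A) (e' * B) (e' * X) (e * B); clear.
by move=> *; apply/andP; split; lra.
Qed.

Variable m : R.

(** The standard bubble as the profile with [A = 1], a form to which the calculus
    of profiles applies. *)
Definition bubble x : R := profile 1 m (dist2 x 0).

Let dom1 : set R := [set s | 0 < 1 + s].

Lemma jet_bubble : jet dom1 (profile 1 m) (profile1 1 m) (profile2 1 m).
Proof.
split.
- apply: smooth_fun1_smooth1; last exact: smooth_fun1_profile.
  exact: open_shift_gt0.
- by move=> s ds; exact: is_derive_profile.
- by move=> s ds; exact: is_derive_profile1.
Qed.

Lemma dom1_ge0 s : 0 <= s -> dom1 s.
Proof. by move=> s0; rewrite /dom1/= ltr_pwDl. Qed.

Lemma smooth_fun_bubble D : smooth_fun basis D bubble.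
Proof. exact: smooth_fun_radial dom1_ge0 jet_bubble. Qed.

Lemma bubble_gt0 x : 0 < bubble x.
Proof. by apply: powR_gt0; apply: dom1_ge0; exact: dist2_ge0. Qed.

Hypothesis nm : n%:R = 2 * m + 2.
Hypothesis m0 : 0 < m.
Let p := (m + 2) / m.

Lemma laplacian_bubble x :
  - laplacian bubble x / (n%:R * (n%:R - 2)) = bubble x `^ p.
Proof.
rewrite (radialN_laplacian m dom1 (profile 1 m) (profile1 1 m) (profile2 1 m))//; first last.
- exact: jet_bubble.
- exact: dom1_ge0.
have d0 := dist2_ge0 x 0.
rewrite radialN_profile//; last exact: dom1_ge0.
rewrite subrr mulr0 mul0r subr0 mulr1 mulrAC divff ?mul1r; last first.
  by rewrite lt0r_neq0// mulr_gt0// addr_gt0.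
rewrite /bubble /profile -powRrM /p -opprD; congr (_ `^ _).
by field; rewrite lt0r_neq0.
Qed.

(** The radius is first made so small that the background is almost constant, and
    the bump is then chosen inside that ball; beyond [r] nothing is changed and the
    estimate is trivial. *)
Lemma one_bump y (e M rmax : R) : 0 < e -> 0 < rmax -> exists r J g g1 g2,
  [/\ 0 < r <= rmax, (forall s, 0 <= s -> J s), jet J g g1 g2,
   (forall s, r ^+ 2 <= s -> [/\ g s = 0, g1 s = 0 & g2 s = 0]) &
   M <= g 0 /\ forall x, let s := dist2 x y in 0 <= g s /\
     `|bubble x `^ p + radialN m s (g1 s) (g2 s) - (bubble x + g s) `^ p| <=
        e * (bubble x + g s) `^ p].
Proof.
move=> e0 rm0; have p0 : 0 < p by rewrite divr_gt0// addr_gt0.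
have [d [e' [d0 e'0 dP]]] := shift_estimate p e p0 e0.
have a0 := bubble_gt0 y.
have bc : {for y, continuous bubble}.
  exact: smooth_fun_continuous basis setT openT _ (smooth_fun_bubble setT) y I.
have [r1 r10 r1P] := continuous_dist2_ball bubble y (d * bubble y) bc (mulr_gt0 d0 a0).
pose r := Num.min r1 rmax.
have r0 : 0 < r by rewrite lt_min r10.
have r20 : 0 < r ^+ 2 by rewrite exprn_gt0.
have [J [g [g1 [g2 [oJ J0 jg gr [gM gE]]]]]] := local_bump m (bubble y) e' M (r ^+ 2) m0 a0 e'0 r20.
exists r, J, g, g1, g2; split=> //.
  by rewrite r0 ge_min lexx orbT.
split=> // x s; have s0 : 0 <= s by exact: dist2_ge0.
have [g0 gs] := gE s s0; split; first exact: g0.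
have [sr|sr] := ltP s (r ^+ 2).
  apply: (dP (bubble y)) => //; apply: r1P; apply: lt_le_trans sr _.
  by rewrite lerXn2r// ?nnegrE ?(ltW r0) ?(ltW r10)// ge_min lexx.
have [-> -> ->] := gr s sr.
rewrite /radialN !mulr0 addr0 oppr0 mul0r !addr0 subrr normr0.
by rewrite mulr_ge0 ?powR_ge0// ltW.
Qed.

End OneBump.

(** * Infinitely many bumps *)
Section Scales.
Context {R : realType}.

Definition scale (i : nat) : R := 2^-1 ^+ i.

Lemma scale_gt0 i : 0 < scale i.
Proof. by rewrite exprn_gt0// invr_gt0. Qed.

Lemma scale_le1 i : scale i <= 1.
Proof. by rewrite exprn_ile1 ?invr_ge0// invf_le1// ler1n. Qed.

Lemma scaleS i : scale i.+1 = scale i / 2.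
Proof. by rewrite /scale exprSr. Qed.

Lemma scale_le i j : (i <= j)%N -> scale j <= scale i.
Proof.
by move=> ij; rewrite /scale ler_wiXn2l ?invr_ge0// invf_le1// ler1n.
Qed.

Lemma cvg_scale : scale i @[i --> \oo] --> (0 : R).
Proof. by apply: cvg_expr; rewrite ger0_norm ?invr_ge0// invf_lt1// ltr1n. Qed.

Lemma scale_small (e : R) : 0 < e -> exists N, forall i, (N <= i)%N -> scale i < e.
Proof.
move=> e0; have /cvgrPdist_lt/(_ _ e0)[N _ NP] := cvg_scale.
exists N => i Ni; have := NP i Ni.
by rewrite /= sub0r normrN gtr0_norm// scale_gt0.
Qed.

Lemma sum_scale N : \sum_(i < N) scale i.+1 = 1 - scale N.
Proof.
elim: N => [|N IH]; first by rewrite big_ord0 /scale expr0 subrr.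
by rewrite big_ord_recr/= IH scaleS; field.
Qed.

End Scales.

Section Covering.
Context {R : realType} {n : nat}.

(** Each ball is covered by the cube of side [2 r i <= 1], whose volume is at most
    [2 r i] as [n >= 1]. *)
Lemma lebesgue_measure_balls (y : nat -> 'rV[R]_n) (r : nat -> R) (mu : R) :
  (0 < n)%N -> (forall i, 0 < r i) -> (forall i, 2 * r i <= 1) ->
  (forall i, 2 * r i <= mu * scale i.+1) -> 0 <= mu ->
  (lebesgue_measure_rV (\bigcup_i [set x | (dist2 x (y i) < r i ^+ 2)%R]) <= mu%:E)%E.
Proof.
move=> n0 r0 r1 rmu mu0.
pose a k : 'rV[R]_n := \row_i (y k ord0 i - r k).
pose b k : 'rV[R]_n := \row_i (y k ord0 i + r k).
have vol k : box_volume (a k) (b k) = (2 * r k) ^+ n.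
  rewrite /box_volume (eq_bigr (fun=> 2 * r k)); last by move=> i _; rewrite !mxE; ring.
  by rewrite prodr_const card_ord.
have vol0 k : 0 <= box_volume (a k) (b k).
  by rewrite vol exprn_ge0// mulr_ge0// ltW.
apply: (@le_trans _ _ (\sum_(0 <= k <oo) (box_volume (a k) (b k))%:E)%E).
  apply: ereal_inf_lbound; exists a, b; split=> //.
    by move=> k i; rewrite !mxE; have := r0 k; lra.
  move=> x [k _ /= xk]; exists k => // i; rewrite !mxE.
  have := coord_lt_dist2 x (y k) (r k) i (r0 k) xk.
  by rewrite ltr_norml => /andP[]; move=> *; apply/andP; split; lra.
apply: lime_le; first by apply: is_cvg_nneseries => k _ _; rewrite lee_fin.
apply: nearW => N; rewrite sumEFin lee_fin big_mkord.
apply: (@le_trans _ _ (\sum_(k < N) mu * scale k.+1)).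
  apply: ler_sum => k _; rewrite vol; apply: le_trans (rmu k).
  case: n n0 => // n' _; rewrite exprS ler_piMr ?mulr_ge0 ?(ltW (r0 _))//.
  by rewrite exprn_ile1 ?mulr_ge0 ?(ltW (r0 _)).
rewrite -mulr_sumr sum_scale ler_piMr// lerBlDr lerDl.
exact/ltW/scale_gt0.
Qed.

End Covering.

Section Superposition.
Context {R : realType} {n : nat}.
Variables (m : R) (i0 : 'I_n) (r : nat -> R) (J : nat -> set R) (g g1 g2 : nat -> R -> R).
Implicit Types (x : 'rV[R]_n).

Definition center i : 'rV[R]_n := scale i *: basis i0.

Lemma center0 i : center i ord0 i0 = scale i.
Proof. by rewrite !mxE !eqxx mulr1. Qed.

Lemma dist2_center i : dist2 (center i) 0 = scale i ^+ 2.
Proof.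
rewrite /dist2 (bigD1 i0)//= center0 mxE subr0 big1 ?addr0// => j /negbTE ji.
by rewrite !mxE ji andbF mulr0 subr0 expr0n.
Qed.

Lemma enorm_center i : enorm (center i) = scale i.
Proof.
have e0 : 0 <= enorm (center i) by exact: sqrtr_ge0.
apply/eqP; rewrite -(@eqrXn2 _ 2)// ?(ltW (scale_gt0 i))//.
by rewrite -dist2_0 dist2_center.
Qed.

Definition bump i x : R := g i (dist2 x (center i)).
Definition bumpN i x : R :=
  radialN m (dist2 x (center i)) (g1 i (dist2 x (center i))) (g2 i (dist2 x (center i))).

(** The regions increase to the punctured space, and only the first [N] bumps meet
    the region of index [N]: a ball of radius at most [scale i / 8] around a point at
    distance [scale i] from 0 stays below the distance [2 * scale i]. *)
Definition region (N : nat) : set 'rV[R]_n := [set x | 4 * scale N ^+ 2 < dist2 x 0].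

Lemma open_region N : open (region N).
Proof. exact: open_dist2_gt. Qed.

Lemma region_cover x : x != 0 -> exists N, region N x.
Proof.
move=> /dist2_0_gt0 d0; have [|N /(_ N (leqnn N)) NP] := @scale_small R (dist2 x 0 / 4).
  by rewrite divr_gt0.
exists N; rewrite /region/= mulrC -ltr_pdivlMr// (le_lt_trans _ NP)//.
rewrite expr2 ler_piMr ?(ltW (scale_gt0 _))//; exact: scale_le1.
Qed.

Hypothesis r_gt0 : forall i, 0 < r i.
Hypothesis r_le : forall i, r i <= scale i / 8.
Hypothesis g_far : forall i s, r i ^+ 2 <= s -> [/\ g i s = 0, g1 i s = 0 & g2 i s = 0].

Lemma far_center N i x : region N x -> (N <= i)%N -> r i ^+ 2 <= dist2 x (center i).
Proof.
move=> Nx Ni; rewrite leNgt; apply/negP => xi.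
have := dist2_tri x (center i) 0; rewrite dist2_center.
have := scale_le i N; move: Nx; rewrite /region/=.
have := @scale_le R _ _ Ni; have := r_le i; have := r_gt0 i; have := @scale_gt0 R i; have := @scale_gt0 R N.
move: (scale i) (scale N) (r i) (dist2 x 0) (dist2 x _) xi => ti tN ri d e.
move=> er tN0 ti0 r0 rt tt td _; rewrite leNgt => /negP; apply.
have h1 : ri ^+ 2 <= ti ^+ 2 by rewrite lerXn2r// ?nnegrE; lra.
have h2 : ti ^+ 2 <= tN ^+ 2 by rewrite lerXn2r// ?nnegrE; lra.
by move: (ri ^+ 2) (ti ^+ 2) (tN ^+ 2) er td h1 h2 => *; lra.
Qed.

Lemma ball_coord i x : dist2 x (center i) < r i ^+ 2 -> `|x ord0 i0 - scale i| < scale i / 8.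
Proof.
move=> /(coord_lt_dist2 _ _ _ i0 (r_gt0 i)); rewrite center0 => /lt_le_trans; apply.
exact: r_le.
Qed.

Lemma ball_punctured i x : dist2 x (center i) < r i ^+ 2 -> x != 0.
Proof.
move=> /ball_coord; apply: contraTneq => ->; rewrite mxE sub0r normrN gtr0_norm ?scale_gt0//.
by have := @scale_gt0 R i; rewrite -leNgt; lra.
Qed.

(** The coordinate along [i0] already separates the balls: it lies strictly between
    [7/8] and [9/8] of [scale i]. *)
Lemma balls_disjoint i j x : dist2 x (center i) < r i ^+ 2 ->
  dist2 x (center j) < r j ^+ 2 -> i = j.
Proof.
wlog ij : i j / (i <= j)%N.
  by move=> H xi xj; have [/H|/ltnW/H] := leqP i j; [apply|move=> H'; apply/esym/H'].
move=> /ball_coord xi /ball_coord xj; apply/eqP; rewrite eqn_leq ij/= leqNgt.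
apply/negP => /(@scale_le R); rewrite scaleS; have := @scale_gt0 R j.
move: xi xj; rewrite !ltr_norml => /andP[+ _] /andP[_ +]; lra.
Qed.

Lemma bump_far i x : r i ^+ 2 <= dist2 x (center i) -> bump i x = 0 /\ bumpN i x = 0.
Proof.
by move=> /g_far[E E1 E2]; rewrite /bump /bumpN E E1 E2 /radialN !mulr0 addr0 oppr0 mul0r.
Qed.

Lemma sums_in N i x : region N x -> dist2 x (center i) < r i ^+ 2 ->
  \sum_(j < N) bump j x = bump i x /\ \sum_(j < N) bumpN j x = bumpN i x.
Proof.
move=> Nx xi; have iN : (i < N)%N.
  by rewrite ltnNge; apply/negP => /(far_center _ _ _ Nx); rewrite leNgt xi.
have other (j : 'I_N) : j != Ordinal iN -> bump j x = 0 /\ bumpN j x = 0.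
  move=> ji; apply: bump_far; rewrite leNgt; apply: contra ji => xj.
  by apply/eqP/val_inj/esym; exact: balls_disjoint xi xj.
by split; rewrite (bigD1 (Ordinal iN))//= big1 ?addr0// => j /other[].
Qed.

Lemma sums_out N x : (forall i, r i ^+ 2 <= dist2 x (center i)) ->
  \sum_(j < N) bump j x = 0 /\ \sum_(j < N) bumpN j x = 0.
Proof. by move=> H; split; apply: big1 => j _; have [] := bump_far j x (H j). Qed.

(** The number of bumps to be summed at a point: any index of a region containing
    it gives the same sum ([solutionE]). *)
Definition level x : nat := xget 0%N [set N | region N x].

Definition solution x : R := bubble m x + \sum_(j < level x) bump j x.

Lemma solutionE N x : region N x -> solution x = bubble m x + \sum_(j < N) bump j x.
Proof.
(* The default value of xget is never reached, as x lies in region N. *)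
move=> Nx; have Lx : region (level x) x by apply: (@xgetPex _ 0%N [set N | region N x]); exists N.
rewrite /solution; congr (_ + _).
have [[i xi]|H] := pselect (exists i, dist2 x (center i) < r i ^+ 2).
  by have [-> _] := sums_in _ _ _ Nx xi; have [-> _] := sums_in _ _ _ Lx xi.
have {}H i : r i ^+ 2 <= dist2 x (center i).
  by rewrite leNgt; apply/negP => xi; apply: H; exists i.
by have [-> _] := sums_out N x H; have [-> _] := sums_out (level x) x H.
Qed.

Hypothesis J_ge0 : forall i s, 0 <= s -> J i s.
Hypothesis g_jet : forall i, jet (J i) (g i) (g1 i) (g2 i).
Hypothesis g_ge0 : forall i x, 0 <= bump i x.
Hypothesis nm : n%:R = 2 * m + 2.
Hypothesis m0 : 0 < m.

Lemma smooth_fun_bump D i : smooth_fun basis D (bump i).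
Proof. exact: smooth_fun_radial (J_ge0 i) (g_jet i). Qed.

Lemma smooth_fun_solution N : smooth_fun basis (region N) solution.
Proof.
apply: (smooth_fun_ext _ _ (fun x => bubble m x + \sum_(j < N) bump j x)).
  by move=> x Nx; rewrite (solutionE N).
apply: smooth_fun_add; first exact: smooth_fun_bubble.
by apply: smooth_fun_sum => j; exact: smooth_fun_bump.
Qed.

Lemma bubble_le_solution x : bubble m x <= solution x.
Proof. by rewrite lerDl; apply: sumr_ge0. Qed.

Lemma solution_gt0 x : 0 < solution x.
Proof. exact: lt_le_trans (bubble_gt0 m x) (bubble_le_solution x). Qed.

Lemma laplacian_solution N x : region N x ->
  - laplacian solution x / (n%:R * (n%:R - 2)) =
  bubble m x `^ ((m + 2) / m) + \sum_(j < N) bumpN j x.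
Proof.
move=> Nx; have oN := open_region N.
rewrite (laplacian_ext (region N) _ (fun x => bubble m x + \sum_(j < N) bump j x) oN)//; last first.
  by move=> y Ny; rewrite (solutionE N).
rewrite (laplacianD (region N))//; last 2 first.
- exact: smooth_fun_bubble.
- by apply: smooth_fun_sum => j; exact: smooth_fun_bump.
rewrite (laplacian_sum (region N))//; last by move=> j; exact: smooth_fun_bump.
rewrite opprD mulrDl -laplacian_bubble//; congr (_ + _).
rewrite -sumrN mulr_suml; apply: eq_bigr => j _.
exact: (radialN_laplacian m (J j) _ _ _ _ _ nm m0 (J_ge0 j) (g_jet j)).
Qed.

(** The function [K] is read off from the equation. *)
Definition curvature x : R :=
  - laplacian solution x / (n%:R * (n%:R - 2)) / solution x `^ ((m + 2) / m).

Lemma smooth_fun_curvature N : smooth_fun basis (region N) curvature.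
Proof.
have oN := open_region N; have sN := smooth_fun_solution N.
apply: (smooth_fun_ext _ _ (fun x => (laplacian solution x * (- (n%:R * (n%:R - 2))^-1)) *
  solution x `^ (- ((m + 2) / m)))).
  by move=> x _; rewrite powRN /curvature !(mulrN, mulNr).
apply: smooth_fun_mul.
  by apply: (smooth_fun_mul _ _ _ (fun=> _)); [exact: smooth_fun_laplacian|exact: smooth_fun_cst].
apply: (smooth_fun_comp _ _ [set x : R | 0 < x] (fun t : R => t `^ (- ((m + 2) / m))) solution) => //.
  exact: smooth1_powR.
by move=> x _; exact: solution_gt0.
Qed.

Lemma solution_outside x : x != 0 -> (forall i, r i ^+ 2 <= dist2 x (center i)) ->
  curvature x = 1 /\ solution x = bubble m x.
Proof.
move=> /region_cover[N Nx] xout; have [S0 S1] := sums_out N x xout.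
have uE : solution x = bubble m x by rewrite (solutionE N)// S0 addr0.
split=> //; rewrite /curvature (laplacian_solution N)// S1 addr0 uE divff//.
by rewrite lt0r_neq0// powR_gt0// bubble_gt0.
Qed.

(** At most one bump is nonzero at [x], so its estimate is the estimate for the
    sum. *)
Lemma curvature_close e x : 0 <= e -> x != 0 ->
  (forall i, let p := (m + 2) / m in
   `|bubble m x `^ p + bumpN i x - (bubble m x + bump i x) `^ p|
     <= e * (bubble m x + bump i x) `^ p) ->
  `|curvature x - 1| <= e.
Proof.
move=> e0 x0 est; have [N Nx] := region_cover x x0.
have [[i xi]|H] := pselect (exists i, dist2 x (center i) < r i ^+ 2); last first.
  have [|-> _] := solution_outside x x0; last by rewrite subrr normr0.
  by move=> i; rewrite leNgt; apply/negP => xi; apply: H; exists i.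
have [S0 S1] := sums_in N i x Nx xi; have := est i.
rewrite /= /curvature (laplacian_solution N)// (solutionE N)// S0 S1.
have B0 : 0 < (bubble m x + bump i x) `^ ((m + 2) / m).
  by rewrite powR_gt0// ltr_wpDr// bubble_gt0.
move: (_ `^ _ + bumpN i x) (_ `^ _) B0 => A B B0 AB.
by rewrite -[X in _ - X](divff (lt0r_neq0 B0)) -mulrBl normrM normfV [`|B|]gtr0_norm// ler_pdivrMr.
Qed.

Lemma solution_center i : g i 0 <= solution (center i).
Proof.
have ci : dist2 (center i) (center i) = 0.
  by rewrite /dist2 big1// => j _; rewrite subrr expr0n.
have cN : center i != 0.
  by apply: (ball_punctured i); rewrite ci exprn_gt0.
have [N Nx] := region_cover _ cN.
have [|S0 _] := sums_in N i _ Nx; first by rewrite ci exprn_gt0.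
by rewrite (solutionE N)// S0 /bump ci lerDr ltW// bubble_gt0.
Qed.

End Superposition.

(** * The theorem *)
Lemma smooth_on_punctured {R : realType} {n : nat} (f : 'rV[R]_n -> R) :
  (forall N, smooth_fun basis (region N) f) -> smooth_on punctured f.
Proof.
move=> fN s x /region_cover[N Nx].
exact: (smooth_fun_smooth_on _ _ (open_region N) (fN N)).
Qed.

Lemma standard_bubbleE {R : realType} {n : nat} (x : 'rV[R]_n) :
  standard_bubble x = bubble ((n%:R - 2) / 2) x.
Proof.
have x0 : 0 < 1 + enorm x ^+ 2 by rewrite ltr_pwDl// sqr_ge0.
rewrite /standard_bubble /bubble /profile dist2_0 -(powR_div _ 1 _ ltr01 x0).
by rewrite powR1 mul1r.
Qed.

(** Slow decay would bound [u(x) |x| ^ m] near 0. *)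
Lemma blow_up_of_sequence {R : realType} {n : nat} (m : R) (u : 'rV[R]_n -> R)
    (y : nat -> 'rV[R]_n) : (2 - n%:R) / 2 = - m ->
  (forall i, punctured (y i)) -> (forall i, 0 < enorm (y i)) ->
  enorm (y i) @[i --> \oo] --> (0 : R) ->
  (forall i, i%:R <= u (y i) * enorm (y i) `^ m) -> ~ slow_decay u.
Proof.
move=> nm y0 e0 cy uy [C [C0 [d [d0 H]]]].
have /cvgrPdist_lt/(_ _ d0)[N _ NP] := cy.
pose i := (N + (Num.truncn C).+1)%N.
have yd : enorm (y i) < d.
  have := NP i (leq_addr _ _).
  by rewrite /= sub0r normrN gtr0_norm.
have := H (y i) (y0 i) yd; rewrite nm powRN ler_pdivlMr ?powR_gt0//.
move=> /(le_trans (uy i)); apply/negP; rewrite -ltNge.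
apply: lt_le_trans (truncnS_gt C) _.
by rewrite ler_nat leq_addl.
Qed.

Theorem mainTheorem1 (R : realType) (n : nat) (hn : (3 <= n)%N)
    (eps mu : R) (heps : 0 < eps) (hmu : 0 < mu)
    (rho : R -> R) (hrho : forall r : R, 0 < r -> 0 < rho r) :
  exists (K u : 'rV[R]_n -> R) (U : set 'rV[R]_n) (x_ : nat -> 'rV[R]_n),
    (smooth_on punctured K /\
      (forall x, punctured x -> `|K x - 1| <= eps)) /\
    (smooth_on punctured u /\ (forall x, punctured x -> 0 < u x)) /\
    (open U /\ U `<=` punctured /\ (lebesgue_measure_rV U <= mu%:E)%E) /\
    ((forall i, punctured (x_ i)) /\ enorm (x_ i) @[i --> \oo] --> (0 : R)) /\
    (* (i) *)
    solves K u /\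
    (* (ii) *)
    ((forall i, rho (enorm (x_ i)) <= u (x_ i)) /\
      u (x_ i) * enorm (x_ i) `^ ((n%:R - 2) / 2) @[i --> \oo] --> +oo /\
      blow_up_solution K u) /\
    (* (iii) *)
    (forall x, punctured x -> ~ U x ->
      K x = 1 /\ u x = standard_bubble x).
Proof.
pose m : R := (n%:R - 2) / 2.
have n2 : 2 < n%:R :> R by rewrite ltr_nat.
have m0 : 0 < m by rewrite divr_gt0// subr_gt0.
have nm : n%:R = 2 * m + 2 by rewrite /m; field.
have n0 : (0 < n)%N by apply: leq_trans hn.
pose i0 : 'I_n := Ordinal n0.
pose y := @center R n i0.
(* The first value gives the growth rho, the second one makes u(x_i) |x_i| ^ m at least i. *)
pose M i := Num.max (rho (scale i)) (i%:R * scale i `^ (- m)).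
(* The first bound separates the balls, the second one makes their volumes sum up to at most mu. *)
pose rmax i : R := Num.min (scale i / 8) (mu * scale i.+1 / 2).
have rm0 i : 0 < rmax i.
  by rewrite lt_min !divr_gt0 ?mulr_gt0 ?scale_gt0.
pose P i (b : R * set R * (R -> R) * (R -> R) * (R -> R)) :=
  let: (r, J, g, g1, g2) := b in
  [/\ 0 < r <= rmax i, (forall s, 0 <= s -> J s), jet J g g1 g2,
   (forall s, r ^+ 2 <= s -> [/\ g s = 0, g1 s = 0 & g2 s = 0]) &
   M i <= g 0 /\ forall x, let s := dist2 x (y i) in let p := (m + 2) / m in 0 <= g s /\
     `|bubble m x `^ p + radialN m s (g1 s) (g2 s) - (bubble m x + g s) `^ p| <=
        eps * (bubble m x + g s) `^ p].
have /choice[b bP] : forall i, exists b, P i b.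
  move=> i; have [r [J [g [g1 [g2 H]]]]] := one_bump m m0 (y i) eps (M i) (rmax i) heps (rm0 i).
  by exists (r, J, g, g1, g2).
pose r i := (b i).1.1.1.1; pose J i := (b i).1.1.1.2; pose g i := (b i).1.1.2.
pose g1 i := (b i).1.2; pose g2 i := (b i).2.
have H i : [/\ 0 < r i <= rmax i, (forall s, 0 <= s -> J i s), jet (J i) (g i) (g1 i) (g2 i),
   (forall s, r i ^+ 2 <= s -> [/\ g i s = 0, g1 i s = 0 & g2 i s = 0]) &
   M i <= g i 0 /\ forall x, let p := (m + 2) / m in 0 <= bump i0 g i x /\
     `|bubble m x `^ p + bumpN m i0 g1 g2 i x - (bubble m x + bump i0 g i x) `^ p| <=
        eps * (bubble m x + bump i0 g i x) `^ p].
  rewrite /r /J /bump /bumpN /g /g1 /g2.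
  by move: (bP i); case: (b i) => [[[[? ?] ?] ?] ?].
have r_gt0 i : 0 < r i by have [/andP[]] := H i.
have r_le i : r i <= scale i / 8.
  by have [/andP[_ +] _ _ _ _] := H i; rewrite le_min => /andP[].
have r_mu i : 2 * r i <= mu * scale i.+1.
  by have [/andP[_ +] _ _ _ _] := H i; rewrite le_min => /andP[_]; rewrite ler_pdivlMr// mulrC.
have J_ge0 i : forall s, 0 <= s -> J i s by have [] := H i.
have g_jet i : jet (J i) (g i) (g1 i) (g2 i) by have [] := H i.
have g_far i : forall s, r i ^+ 2 <= s -> [/\ g i s = 0, g1 i s = 0 & g2 i s = 0].
  by have [] := H i.
have g_ge0 i x : 0 <= bump i0 g i x by have [_ _ _ _ [_ /(_ x)[]]] := H i.
have Mg i : M i <= g i 0 by have [_ _ _ _ []] := H i.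
pose u := solution m i0 g; pose K := curvature m i0 g.
pose U := \bigcup_i [set x | dist2 x (y i) < r i ^+ 2].
have u0 x : 0 < u x by exact: solution_gt0.
have su : smooth_on punctured u.
  by apply: smooth_on_punctured => N; exact: (smooth_fun_solution m i0 r J g g1 g2).
have sK : smooth_on punctured K.
  by apply: smooth_on_punctured => N; exact: (smooth_fun_curvature m i0 r J g g1 g2).
have ey i : enorm (y i) = scale i by exact: enorm_center.
have py i : punctured (y i).
  apply: (ball_punctured i0 r r_gt0 r_le i).
  by rewrite /dist2 big1 ?exprn_gt0// => j _; rewrite subrr expr0n.
have uM i : M i <= u (y i).
  exact: le_trans (Mg i) (solution_center m i0 r g g1 g2 r_gt0 r_le g_far i).
have um i : i%:R <= u (y i) * enorm (y i) `^ m.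
  have := uM i; rewrite ge_max powRN => /andP[_].
  by rewrite ler_pdivrMr ?powR_gt0 ?scale_gt0// ey.
have cy : enorm (y i) @[i --> \oo] --> (0 : R).
  by rewrite (_ : (fun i => _) = scale); [exact: cvg_scale|apply/funext => i; exact: ey].
have sol : solves K u.
  move=> x x0; rewrite /K /curvature -/u.
  have -> : (n%:R + 2) / (n%:R - 2) = (m + 2) / m.
    by rewrite nm; field; apply/andP; split; rewrite lt0r_neq0//; clear -m0; lra.
  have up : u x `^ ((m + 2) / m) != 0 by rewrite lt0r_neq0// powR_gt0.
  have nn : n%:R * (n%:R - 2) != 0 :> R.
    by rewrite lt0r_neq0// mulr_gt0 ?subr_gt0// (lt_trans _ n2).
  by rewrite -mulrA divfK// mulrC divfK// subrr.
have out x : ~ U x -> forall i, r i ^+ 2 <= dist2 x (y i).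
  by move=> Ux i; rewrite leNgt; apply/negP => xi; apply: Ux; exists i.
exists K, u, U, y; split; [|split; [|split; [|split; [|split; [|split]]]]].
- split=> // x x0; apply: (curvature_close m i0 r J g g1 g2) => //; first exact: ltW.
  by move=> i; have [_ _ _ _ [_ /(_ x)[]]] := H i.
- by split.
- split; first by apply: bigcup_open => i _; exact: open_dist2_lt.
  split; first by move=> x [i _ /(ball_punctured i0 r r_gt0 r_le i)].
  apply: lebesgue_measure_balls => //; last exact: ltW.
  move=> i; have := r_le i; have := @scale_le1 R i; lra.
- by [].
- exact: sol.
- split; first by move=> i; rewrite ey; have := uM i; rewrite ge_max => /andP[].
  split.
    apply: (@ger_cvgy _ _ _ _ (fun i : nat => i%:R : R)); last exact: cvgr_idn.
    exact: nearW.
  split=> //; apply: (blow_up_of_sequence m) py _ cy um.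
    by rewrite /m; field.
  by move=> i; rewrite ey scale_gt0.
- move=> x x0 /out xo.
  rewrite standard_bubbleE.
  exact: (solution_outside m i0 r J g g1 g2 r_gt0 r_le g_far J_ge0 g_jet nm m0 x x0 xo).
Qed.
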